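(* Let $n\ge 2$ and let $u\in\mathcal{S}_n$ be such that $\lambda_u$ is an automorphism of $\mathcal{O}_n$. Suppose there exists a sequence $\{P_m\}_{m\ge 1}$ of non-zero projections in $\mathcal{D}_n$ such that $$\frac{\tau(\lambda_u(P_m))}{\tau(P_m)}\to\infty\quad\text{or}\quad \frac{\tau(\lambda_u(P_m))}{\tau(P_m)}\to 0\qquad (m\to\infty).$$ Then for all unitaries $w\in\mathcal{U}(\mathcal{O}_n)$ and $v\in\mathcal{U}(\mathcal{F}_n)$ we have $\lambda_u\neq \mathrm{Ad}(w)\circ\lambda_v$. In particular, $\mathcal{F}_n$ and $\lambda_u(\mathcal{F}_n)$ are not inner conjugate, i.e. there is no unitary $w\in\mathcal{O}_n$ with $w\mathcal{F}_nw^*=\lambda_u(\mathcal{F}_n)$.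
   Context: $\mathcal{O}_n$ is the Cuntz algebra: the universal $C^*$-algebra generated by isometries $S_1,\dots,S_n$ with $\sum_{i=1}^n S_iS_i^*=1$. $W_n^k$ is the set of words $\mu=(\mu_1,\dots,\mu_k)$ with $\mu_i\in\{1,\dots,n\}$, $W_n^0$ consists of the empty word only, and $W_n=\bigcup_{k\ge0}W_n^k$. For $\mu\in W_n^k$ write $|\mu|=k$ and $S_\mu=S_{\mu_1}\cdots S_{\mu_k}$, with $S_\mu=1$ for the empty word. $\mathcal{F}_n$ is the closed linear span of $\{S_\mu S_\nu^*:|\mu|=|\nu|\}$ (the core UHF-subalgebra, of type $n^\infty$), with unique normalized trace $\tau$; $\mathcal{D}_n$ is the closed linear span of $\{S_\mu S_\mu^*:\mu\in W_n\}$, the diagonal MASA of $\mathcal{O}_n$. $\mathcal{S}_n$ is the group of unitaries in $\mathcal{O}_n$ that can be written as finite sums $u=\sum_{(\alpha,\beta)\in J}S_\alpha S_\beta^*$, where $J$ is a finite collection of pairs $(\alpha,\beta)$ with $\alpha,\beta\in W_n$. $\mathcal{U}(A)$ denotes the unitary group of $A$. For $u\in\mathcal{U}(\mathcal{O}_n)$, $\lambda_u$ is the unital endomorphism of $\mathcal{O}_n$ with $\lambda_u(S_i)=uS_i$, $i=1,\dots,n$. For $u\in\mathcal{S}_n$ one has $\lambda_u(\mathcal{D}_n)\subseteq\mathcal{D}_n$, so $\tau(\lambda_u(P))$ makes sense for projections $P\in\mathcal{D}_n$. $\mathrm{Ad}(w)(x)=wxw^*$. *)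

(* Defs.v *)
From HB Require Import structures.
From mathcomp Require Import all_boot all_order all_algebra.
From mathcomp Require Import complex.
From mathcomp Require Import all_classical all_reals all_analysis.

Set Implicit Arguments.
Unset Strict Implicit.
Unset Printing Implicit Defensive.

Import Order.TTheory GRing.Theory Num.Theory.
Import numFieldNormedType.Exports.

Local Open Scope classical_set_scope.
Local Open Scope complex_scope.
Local Open Scope ring_scope.

(* Unital C*-algebras over R[i].  The norm of a [completeNormedModType R[i]]
   takes its values in R[i] (in the nonnegative reals).

   The product is part of the mixin, and the ring and algebra structures are
   attached to [cstarAlgType] afterwards, because the hierarchy has no common
   ancestor of rings and normed modules below [numDomainType]: a direct join of
   [GRing.Algebra] and [CompleteNormedModule] is rejected. *)
HB.mixin Record isCStarAlgebra (R : realType) A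
    of CompleteNormedModule R[i] A := {
  cstar_one : A;
  cstar_mul : A -> A -> A;
  adj : A -> A;
  cstar_mulA : associative cstar_mul;
  cstar_mul1l : left_id cstar_one cstar_mul;
  cstar_mul1r : right_id cstar_one cstar_mul;
  cstar_mulDl : left_distributive cstar_mul +%R;
  cstar_mulDr : right_distributive cstar_mul +%R;
  cstar_one_neq0 : cstar_one != 0;
  cstar_scaleAl : forall (a : R[i]) x y,
    a *: cstar_mul x y = cstar_mul (a *: x) y;
  cstar_scaleAr : forall (a : R[i]) x y,
    a *: cstar_mul x y = cstar_mul x (a *: y);
  adjK : involutive adj;
  adjD : forall x y, adj (x + y) = adj x + adj y;
  adjZ : forall (a : R[i]) x, adj (a *: x) = Num.conj a *: adj x;
  cstar_adjM : forall x y, adj (cstar_mul x y) = cstar_mul (adj y) (adj x);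
  cstar_normM : forall x y : A, `|cstar_mul x y| <= `|x| * `|y|;
  cstar_norm_adjM : forall x : A, `|cstar_mul (adj x) x| = `|x| ^+ 2
}.

#[short(type="cstarAlgType")]
HB.structure Definition CStarAlgebra (R : realType) :=
  {A of isCStarAlgebra R A & CompleteNormedModule R[i] A}.

HB.instance Definition _ (R : realType) (A : cstarAlgType R) :=
  GRing.Zmodule_isNzRing.Build (CStarAlgebra.sort A)
    cstar_mulA cstar_mul1l cstar_mul1r cstar_mulDl cstar_mulDr cstar_one_neq0.

HB.instance Definition _ (R : realType) (A : cstarAlgType R) :=
  GRing.Lmodule_isLalgebra.Build R[i] (CStarAlgebra.sort A) cstar_scaleAl.

HB.instance Definition _ (R : realType) (A : cstarAlgType R) :=
  GRing.Lalgebra_isAlgebra.Build R[i] (CStarAlgebra.sort A) cstar_scaleAr.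

Lemma adjM (R : realType) (A : cstarAlgType R) (x y : A) :
  adj (x * y) = adj y * adj x.
Proof. exact: cstar_adjM. Qed.

Lemma cstar_normrM (R : realType) (A : cstarAlgType R) (x y : A) :
  `|x * y| <= `|x| * `|y|.
Proof. exact: cstar_normM. Qed.

Lemma cstar_identity (R : realType) (A : cstarAlgType R) (x : A) :
  `|adj x * x| = `|x| ^+ 2.
Proof. exact: cstar_norm_adjM. Qed.

Section CStar.
Context {R : realType}.
Implicit Types A B : cstarAlgType R.

Definition unitary_elt A (u : A) := adj u * u = 1 /\ u * adj u = 1.

Definition is_projection A (p : A) := p * p = p /\ adj p = p.

Definition star_hom A B (f : A -> B) :=
  [/\ forall (a : R[i]) x y, f (a *: x + y) = a *: f x + f y,
      f 1 = 1,
      forall x y, f (x * y) = f x * f y &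
      forall x, f (adj x) = adj (f x)].

Definition star_automorphism A (f : A -> A) := star_hom f /\ bijective f.

Definition Ad A (w : A) : A -> A := fun x => w * x * adj w.

Definition closed_star_subalgebra A (E : set A) :=
  [/\ E 1,
      forall (a : R[i]) x y, E x -> E y -> E (a *: x + y),
      forall x y, E x -> E y -> E (x * y),
      forall x, E x -> E (adj x) &
      closed E].

Definition lin_span A (E : set A) : set A :=
  [set x | exists (m : nat) (c : 'I_m -> R[i]) (e : 'I_m -> A),
     (forall k, E (e k)) /\ x = \sum_k c k *: e k].

Definition closed_lin_span A (E : set A) : set A := closure (lin_span E).

(* A tracial state on the subset F of A; the values of tau outside F are
   irrelevant.  In the order of R[i], [0 <= z] says that z is a nonnegative
   real. *)
Definition normalized_trace A (F : set A) (tau : A -> R[i]) :=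
  [/\ forall (a : R[i]) x y, F x -> F y -> tau (a *: x + y) = a * tau x + tau y,
      forall x, F x -> 0 <= tau (adj x * x),
      tau 1 = 1 &
      forall x y, F x -> F y -> tau (x * y) = tau (y * x)].

Section Cuntz.
Context {n : nat}.

Definition cuntz_family A (S : 'I_n -> A) :=
  (forall i, adj (S i) * S i = 1) /\ \sum_(i < n) S i * adj (S i) = 1.

(* (A, S) is the universal C*-algebra generated by a Cuntz family.  This
   determines (A, S) up to a unique isomorphism. *)
Definition is_cuntz_algebra A (S : 'I_n -> A) :=
  [/\ cuntz_family S,
      forall E : set A,
        closed_star_subalgebra E -> (forall i, E (S i)) -> E = setT &
      forall (B : cstarAlgType R) (T : 'I_n -> B), cuntz_family T ->
        exists! phi : A -> B, star_hom phi /\ forall i, phi (S i) = T i].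

Definition word := seq 'I_n.

Definition S_word A (S : 'I_n -> A) (mu : word) : A := \prod_(i <- mu) S i.

Definition cuntz_core A (S : 'I_n -> A) : set A :=
  closed_lin_span
    [set x | exists mu nu : word,
       size mu = size nu /\ x = S_word S mu * adj (S_word S nu)].

Definition cuntz_diag A (S : 'I_n -> A) : set A :=
  closed_lin_span
    [set x | exists mu : word, x = S_word S mu * adj (S_word S mu)].

Definition cuntz_perm_unitary A (S : 'I_n -> A) (u : A) :=
  unitary_elt u /\
  exists J : seq (word * word),
    uniq J /\ u = \sum_(p <- J) S_word S p.1 * adj (S_word S p.2).

(* The unital *-endomorphism sending S i to u * S i, which by [cuntz_endoP]
   and [cuntz_endo_unique] exists and is unique when u is unitary. *)
Definition cuntz_endo A (S : 'I_n -> A) (u : A) : A -> A :=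
  xget (idfun : A -> A) [set f : A -> A | star_hom f /\ forall i, f (S i) = u * S i].

Lemma cuntz_family_mul A (S : 'I_n -> A) (u : A) :
  cuntz_family S -> unitary_elt u -> cuntz_family (fun i => u * S i).
Proof.
move=> [S1 S2] [u1 u2]; split=> [i|].
  by rewrite adjM -mulrA (mulrA (adj u)) u1 mul1r S1.
under eq_bigr do rewrite adjM mulrA -(mulrA u).
by rewrite -mulr_suml -mulr_sumr S2 mulr1.
Qed.

Lemma cuntz_endoP A (S : 'I_n -> A) (u : A) :
  is_cuntz_algebra S -> unitary_elt u ->
  star_hom (cuntz_endo S u) /\ forall i, cuntz_endo S u (S i) = u * S i.
Proof.
move=> [Sf _ univ] uU; have [f [fP _]] := univ _ _ (cuntz_family_mul Sf uU).
by rewrite /cuntz_endo; case: xgetP => [g _ //|/(_ f)].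
Qed.

Lemma cuntz_endo_unique A (S : 'I_n -> A) (u : A) (f : A -> A) :
  is_cuntz_algebra S -> unitary_elt u ->
  star_hom f -> (forall i, f (S i) = u * S i) -> f = cuntz_endo S u.
Proof.
move=> SC uU fh fS; have gP := cuntz_endoP SC uU.
have [Sf _ univ] := SC; have [h [_ hu]] := univ _ _ (cuntz_family_mul Sf uU).
by rewrite -(hu f) // -(hu (cuntz_endo S u)).
Qed.

End Cuntz.
End CStar.

(* Main.v *)
Require Import Defs.
From HB Require Import structures.
From mathcomp Require Import all_boot all_order all_algebra.
From mathcomp Require Import cyclic separable cyclotomic.
From mathcomp Require Import complex.
From mathcomp Require Import all_classical all_reals all_analysis.
From mathcomp Require Import zify ring lra.
(* [adj] must be the involution, not the adjugate matrix. *)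
Import Defs.

Set Implicit Arguments.
Unset Strict Implicit.
Unset Printing Implicit Defensive.

Import Order.TTheory GRing.Theory Num.Theory.
Import numFieldNormedType.Exports.

Local Open Scope classical_set_scope.
Local Open Scope complex_scope.
Local Open Scope ring_scope.

(** Write F for the core, D for the diagonal and L_u for [cuntz_endo S u].

    Both claims follow from one estimate.  Suppose that w is a unitary such that
    psi x = adj w * L_u x * w maps F into F.  Then tau (L_u P) / tau P stays
    between two positive constants that depend on w only, P running over the
    nonzero projections of D; so these ratios tend neither to infinity nor to 0.
    If L_u = Ad w \o L_v with v in F, then psi = L_v, which commutes with the
    gauge action because v is gauge invariant, and therefore preserves the fixed
    points of that action, which are F ([endo_core]).  If Ad w maps F onto
    L_u F, then Ad (adj w) maps L_u F onto F, so again psi maps F into F.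

    For the estimate, put p = L_u P and q = psi P, so that p = w * q * adj w.
    Both lie in F: for p this is [perm_endo_diag], which holds because a
    permutation unitary multiplies every long word into a single word
    ([perm_word]).  The normalized trace of F is unique, so tau q = tau P
    ([tr_invariant]), and it remains to bound tau p by a multiple of tau q; the
    other bound is the same with adj w for w.  This is [tr_conj_le].  Approximate
    w by a finite sum w' of gauge homogeneous elements y_d.  The element
    p * w' * q * adj w' * p is close to p, and averaging it over the gauge action
    removes the mixed terms and leaves p where it is; hence
    a = \sum_d p * y_d * q * adj y_d * p is close to p and tau p <= 2 tau a.
    Exchanging the factors of x * adj x for a homogeneous x multiplies its trace
    by a power of n ([tr_homog]), so tau a is a combination of traces
    tau (q * b * q), and these are at most a constant times tau q
    ([tr_compress]).  Finally tau P > 0, since a nonzero projection of D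
    dominates some S_mu S_mu^* ([diag_proj_ge_word]).

    The facts about C*-algebras that this uses need neither spectra nor
    representations.  A selfadjoint x of small norm gives a selfadjoint square
    root of 1 - x inside every closed star-subalgebra that contains x
    ([sqrt_one_sub]); this makes traces and star-homomorphisms bounded.  That the
    ranges of the S_i are orthogonal comes from 1 being an extreme point of the
    unit ball ([rnorm_vertex]).  The gauge action is averaged over finite groups
    of roots of unity only. *)

(** * The norm as a real number *)

Section Norm.
Context {R : realType} {A : cstarAlgType R}.
Implicit Types x y : A.

(** The norm of a C*-algebra over R[i] takes values in R[i], whose order is partial;
    its real part is the same number in a totally ordered field. *)
Definition rnorm x : R := complex.Re `|x|.

Lemma rnormE x : `|x| = (rnorm x)%:C.
Proof. by rewrite /rnorm RRe_real // ger0_real. Qed.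

Lemma rnorm_ge0 x : 0 <= rnorm x.
Proof. by rewrite -ler0c -rnormE. Qed.

Lemma rnorm0 : rnorm 0 = 0.
Proof. by rewrite /rnorm normr0. Qed.

Lemma rnorm_eq0 x : rnorm x = 0 -> x = 0.
Proof. by move=> x0; apply/normr0_eq0; rewrite rnormE x0. Qed.

Lemma rnormN x : rnorm (- x) = rnorm x.
Proof. by rewrite /rnorm normrN. Qed.

Lemma rnormBC x y : rnorm (x - y) = rnorm (y - x).
Proof. by rewrite -rnormN opprB. Qed.

Lemma rnormD x y : rnorm (x + y) <= rnorm x + rnorm y.
Proof. by rewrite -lecR rmorphD /= -!rnormE ler_normD. Qed.

Lemma rnormB_tri x y z : rnorm (x - z) <= rnorm (x - y) + rnorm (y - z).
Proof. by rewrite (_ : x - z = (x - y) + (y - z)) ?rnormD // addrA subrK. Qed.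

Lemma rnormM x y : rnorm (x * y) <= rnorm x * rnorm y.
Proof. by rewrite -lecR rmorphM /= -!rnormE cstar_normrM. Qed.

Lemma rnormZ (a : R[i]) x : rnorm (a *: x) = complex.Re `|a| * rnorm x.
Proof.
by apply: complexI; rewrite rmorphM /= -!rnormE normrZ.
Qed.

Lemma rnorm_sum (I : Type) (r : seq I) (P : pred I) (f : I -> A) :
  rnorm (\sum_(i <- r | P i) f i) <= \sum_(i <- r | P i) rnorm (f i).
Proof.
elim/big_ind2: _ => [|x a y b xa yb|i _]; rewrite ?rnorm0 //.
by apply: (le_trans (rnormD _ _)); apply: lerD.
Qed.

Lemma rnorm_cstar x : rnorm (adj x * x) = rnorm x ^+ 2.
Proof. by apply: complexI; rewrite rmorphXn /= -!rnormE cstar_identity. Qed.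

Lemma adj0 : adj (0 : A) = 0.
Proof. by have := adjZ 0 (0 : A); rewrite rmorph0 !scale0r. Qed.

Lemma adjN x : adj (- x) = - adj x.
Proof. by have := adjZ (-1) x; rewrite rmorphN rmorph1 !scaleN1r. Qed.

Lemma adjB x y : adj (x - y) = adj x - adj y.
Proof. by rewrite adjD adjN. Qed.

Lemma adj1 : adj (1 : A) = 1.
Proof. by rewrite -[LHS]mul1r -[1 in X in X * _]adjK -adjM mul1r adjK. Qed.

Lemma adj_sum (I : Type) (r : seq I) (P : pred I) (f : I -> A) :
  adj (\sum_(i <- r | P i) f i) = \sum_(i <- r | P i) adj (f i).
Proof. by apply: big_morph; [exact: adjD | exact: adj0]. Qed.

(** The C*-identity gives the norm squared of y as at most norm (adj y) times
    norm y; divide by norm y and exchange y with its adjoint. *)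
Lemma rnorm_adj x : rnorm (adj x) = rnorm x.
Proof.
suff H y : rnorm y <= rnorm (adj y).
  by apply/eqP; rewrite eq_le H andbT -[in leRHS](adjK x) H.
have [->|y0] := eqVneq (rnorm y) 0; first exact: rnorm_ge0.
have y_gt0 : 0 < rnorm y by rewrite lt_def y0 rnorm_ge0.
by rewrite -(ler_pM2r y_gt0) -expr2 -rnorm_cstar rnormM.
Qed.

Lemma rnorm1 : rnorm (1 : A) = 1.
Proof.
have := rnorm_cstar 1; rewrite adj1 mulr1 expr2 => /eqP.
rewrite -{1}[rnorm 1]mulr1 (inj_eq (mulfI _)) => [/eqP //|].
by apply/eqP => /rnorm_eq0 /eqP; rewrite oner_eq0.
Qed.

Lemma rnorm_unitary x : unitary_elt x -> rnorm x = 1.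
Proof.
move=> [x1 _]; have := rnorm_cstar x; rewrite x1 rnorm1 => /esym/eqP.
by rewrite sqrf_eq1 => /orP[/eqP //|/eqP x_eq]; have := rnorm_ge0 x; lra.
Qed.

(** The C*-identity reads t = t ^+ 2 for the norm t of a projection. *)
Lemma rnorm_proj_le1 x : is_projection x -> rnorm x <= 1.
Proof.
move=> [x1 x2]; have := rnorm_cstar x; rewrite x2 x1 => x_eq.
by have := rnorm_ge0 x; nra.
Qed.

Lemma proj_compl (p : A) : is_projection p -> is_projection (1 - p).
Proof.
move=> [pp ps]; split; last by rewrite adjB adj1 ps.
by rewrite mulrBl mul1r mulrBr mulr1 pp subrr subr0.
Qed.

Lemma proj_rnorm (p : A) : is_projection p -> p = 0 \/ rnorm p = 1.
Proof.
move=> [pp ps]; have := rnorm_cstar p; rewrite ps pp => /eqP.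
have [/rnorm_eq0 -> _|p0] := eqVneq (rnorm p) 0; first by left.
rewrite expr2 -{1}[rnorm p]mulr1 (inj_eq (mulfI p0)) => /eqP <-; by right.
Qed.

(** Multiplying p - c by 1 - p and by p bounds norm (c *: (1 - p))
    and norm ((1 - c) *: p).  If neither p nor 1 - p vanished, both would have norm
    1, and |c| and |1 - c| would both be at most 1/4. *)
Lemma proj_near_scalar (p : A) (c : R[i]) : is_projection p -> p != 0 ->
  rnorm (p - c%:A) <= 4^-1 -> p = 1.
Proof.
move=> pP p0 pc; have [pp ps] := pP.
have [/eqP|pn] := proj_rnorm pP; first by rewrite (negbTE p0).
have [/eqP|qn] := proj_rnorm (proj_compl pP).
  by rewrite subr_eq0 => /eqP.
have e1 : (1 - p) * (p - c%:A) = - (c *: (1 - p)).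
  by rewrite mulrBr mulrBl mul1r pp subrr sub0r -scalerAr mulr1.
have e2 : p * (p - c%:A) = (1 - c) *: p.
  by rewrite mulrBr pp -scalerAr mulr1 scalerBl scale1r.
have := rnormM (1 - p) (p - c%:A); rewrite e1 rnormN rnormZ qn mulr1 mul1r => c4.
have := rnormM p (p - c%:A); rewrite e2 rnormZ pn mulr1 mul1r => c4'.
have : `|1 : R[i]| <= `|1 - c| + `|c| by rewrite -{1}(subrK c 1) ler_normD.
have cE (z : R[i]) : `|z| = (complex.Re `|z|)%:C by rewrite RRe_real ?ger0_real.
rewrite normr1 (cE c) (cE (1 - c)) -rmorphD -[leLHS]/(1%:C) lecR /=.
by move=> h; rewrite /= in c4 c4'; exfalso; lra.
Qed.

Lemma closure_rnormP (E : set A) x :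
  closure E x <-> forall e : R, 0 < e -> exists2 y, E y & rnorm (x - y) < e.
Proof.
split=> [Ex e e0|H].
  have [|y [Ey]] := Ex (ball x e%:C); first by apply: nbhsx_ballx; rewrite ltcR.
  by rewrite -ball_normE /= rnormE ltcR => xy; exists y.
move=> B /nbhs_ballP [e /= e0 eB].
have e_re : e = (complex.Re e)%:C by rewrite RRe_real // gtr0_real.
have [|y Ey xy] := H (complex.Re e); first by rewrite -ltcR -e_re.
by exists y; split => //; apply: eB; rewrite -ball_normE /= rnormE e_re ltcR.
Qed.

Lemma closed_rnorm (E : set A) x : closed E ->
  (forall e : R, 0 < e -> exists2 y, E y & rnorm (x - y) < e) -> E x.
Proof. by move=> cE H; apply: cE; apply/closure_rnormP. Qed.

Lemma closed_of_rnorm (E : set A) :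
  (forall x, (forall e : R, 0 < e -> exists2 y, E y & rnorm (x - y) < e) -> E x) ->
  closed E.
Proof. by move=> H x /closure_rnormP /H. Qed.

Lemma rnorm_small_eq0 x : (forall e : R, 0 < e -> rnorm x < e) -> x = 0.
Proof.
move=> H; apply: rnorm_eq0; apply/eqP; rewrite eq_le rnorm_ge0 andbT leNgt.
by apply/negP => /H; rewrite ltxx.
Qed.

(** Completeness, in the only form needed: successive distances decrease like 2 ^- k. *)
Lemma geometric_cvg (z : nat -> A) :
  (forall k, rnorm (z k.+1 - z k) <= 2^-1 ^+ k) ->
  exists l, forall e : R, 0 < e -> exists N, forall k, (N <= k)%N -> rnorm (l - z k) < e.
Proof.
move=> zd.
have dist k m : rnorm (z (k + m)%N - z k) <= 2 * 2^-1 ^+ k - 2 * 2^-1 ^+ (k + m).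
  elim: m => [|m IH]; first by rewrite addn0 !subrr rnorm0.
  apply: (le_trans (rnormB_tri _ (z (k + m)%N) _)).
  have := zd (k + m)%N; rewrite addnS exprS; set t : R := _ ^+ (k + m) in IH * => zkm.
  lra.
have dist2 k m : (k <= m)%N -> rnorm (z m - z k) <= 2 * 2^-1 ^+ k.
  move=> /subnKC <-; apply: (le_trans (dist _ _)).
  have t0 : 0 <= (2^-1 : R) ^+ (k + (m - k)) by rewrite exprn_ge0 // invr_ge0.
  lra.
have small (e : R) : 0 < e -> exists N, forall k, (N <= k)%N -> (2 : R) * 2^-1 ^+ k < e.
  move=> e0; have /cvgrPdist_lt/(_ e e0) : (geometric (2 : R) 2^-1) @ \oo --> (0 : R).
    by apply: cvg_geometric; rewrite ger0_norm ?invf_lt1 ?ltr1n ?invr_ge0.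
  case=> N _ HN; exists N => k /HN /=; rewrite sub0r normrN ger0_norm //.
have zC : cauchy (z @ \oo).
  apply: cauchy_exP => e e0.
  have e_re : e = (complex.Re e)%:C by rewrite RRe_real // gtr0_real.
  have [|N HN] := small (complex.Re e); first by rewrite -ltcR -e_re.
  exists (z N); exists N => // m /= Nm.
  rewrite -ball_normE /= -normrN opprB rnormE e_re ltcR.
  by apply: le_lt_trans (HN N (leqnn N)); apply: dist2.
have [l zl] := proj1 (cvg_ex _) (cauchy_cvg _ zC).
exists l => e e0; have /cvgrPdist_lt/(_ e%:C) := zl; rewrite ltcR => /(_ e0) [N _ HN].
by exists N => k /HN /=; rewrite rnormE ltcR.
Qed.

End Norm.

(** * Square roots *)

Section FunctionalCalculus.
Context {R : realType} {A : cstarAlgType R}.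
Implicit Types (x y : A) (E : set A).

Lemma rnormZ_real (a : R) x : 0 <= a -> rnorm (a%:C *: x) = a * rnorm x.
Proof. by move=> a0; rewrite rnormZ ger0_norm ?ler0c. Qed.

Lemma rnormZ_unit (a : R[i]) x : `|a| = 1 -> rnorm (a *: x) = rnorm x.
Proof. by move=> a1; rewrite rnormZ a1 mul1r. Qed.

Section ClosedStarSubalgebra.
Variables (E : set A) (EP : closed_star_subalgebra E).

Lemma csub1 : E 1. Proof. by case: EP. Qed.
Lemma csubM x y : E x -> E y -> E (x * y). Proof. by case: EP => _ _ + _ _; apply. Qed.
Lemma csub_adj x : E x -> E (adj x). Proof. by case: EP => _ _ _ + _; apply. Qed.
Lemma csub_closed : closed E. Proof. by case: EP. Qed.
Lemma csub_lin (a : R[i]) x y : E x -> E y -> E (a *: x + y).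
Proof. by case: EP => _ + _ _ _; apply. Qed.
Lemma csub0 : E 0.
Proof. by have := csub_lin (-1) csub1 csub1; rewrite scaleN1r addNr. Qed.
Lemma csubZ (a : R[i]) x : E x -> E (a *: x).
Proof. by move=> Ex; have := csub_lin a Ex csub0; rewrite addr0. Qed.
Lemma csubD x y : E x -> E y -> E (x + y).
Proof. by move=> Ex Ey; have := csub_lin 1 Ex Ey; rewrite scale1r. Qed.
Lemma csubN x : E x -> E (- x).
Proof. by move=> Ex; have := csubZ (-1) Ex; rewrite scaleN1r. Qed.
Lemma csubB x y : E x -> E y -> E (x - y).
Proof. by move=> Ex Ey; apply/csubD/csubN. Qed.
Lemma csub_sum (I : Type) (r : seq I) (P : pred I) (f : I -> A) :
  (forall i, P i -> E (f i)) -> E (\sum_(i <- r | P i) f i).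
Proof. by move=> Ef; elim/big_ind: _ => //; [exact: csub0 | exact: csubD]. Qed.

End ClosedStarSubalgebra.

(** Used to transfer commutation with x to the square roots given by
    [sqrt_one_sub], and to all of the diagonal from its generators. *)
Lemma commutant_csub x : adj x = x -> closed_star_subalgebra [set y | y * x = x * y].
Proof.
move=> xs; split => /=.
- by rewrite mul1r mulr1.
- by move=> a y z yx zx; rewrite mulrDl mulrDr -scalerAl -scalerAr yx zx.
- by move=> y z yx zx; rewrite -mulrA zx mulrA yx mulrA.
- by move=> y yx; rewrite -{1}xs -adjM -yx adjM xs.
apply: closed_of_rnorm => y H /=; apply/eqP; rewrite -subr_eq0; apply/eqP.
apply: rnorm_small_eq0 => e e0.
have x0 := rnorm_ge0 x.
have [|z /= zx yz] := H (e / (2 * rnorm x + 1)); first by rewrite divr_gt0 //; lra.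
have -> : y * x - x * y = (y - z) * x - x * (y - z).
  by rewrite mulrBl mulrBr zx opprB addrA subrK.
apply: (le_lt_trans (rnormD _ _)); rewrite rnormN.
apply: (le_lt_trans (lerD (rnormM _ _) (rnormM _ _))).
move: yz; rewrite ltr_pdivlMr; last by lra.
by have := rnorm_ge0 (y - z); nra.
Qed.

(** The root is 1 - z, where z solves z = (x + z ^+ 2) / 2.  On the ball of radius
    1/2 the right-hand side is a contraction of ratio 1/2, so iteration from 0
    converges; the iterates are polynomials in x, whence the last clause. *)
Lemma sqrt_one_sub x : adj x = x -> rnorm x <= 2^-1 ->
  exists y, [/\ adj y = y, y * y = 1 - x &
    forall E, closed_star_subalgebra E -> E x -> E y].
Proof.
move=> xs xn.
pose h : R[i] := (2^-1)%:C.
have hn (z : A) : rnorm (h *: z) = 2^-1 * rnorm z by rewrite /h rnormZ_real // invr_ge0.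
pose z k := iter k (fun t : A => h *: (x + t * t)) 0.
have zn k : rnorm (z k) <= 2^-1.
  elim: k => [|k IH]; first by rewrite rnorm0 invr_ge0.
  rewrite /= hn; have := rnormD x (z k * z k); have := rnormM (z k) (z k).
  by have := rnorm_ge0 (z k); rewrite -/(z k); nra.
(* z |-> z ^+ 2 is Lipschitz on bounded sets, also for noncommuting arguments. *)
have sqB (s t : A) : rnorm (s * s - t * t) <= (rnorm s + rnorm t) * rnorm (s - t).
  have -> : s * s - t * t = s * (s - t) + (s - t) * t.
    by rewrite mulrBr mulrBl addrA subrK.
  apply: (le_trans (rnormD _ _)); rewrite [leRHS]mulrDl; apply: lerD; first exact: rnormM.
  by rewrite [leRHS]mulrC; exact: rnormM.
have stepB (s t : A) : h *: (x + s) - h *: (x + t) = h *: (s - t).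
  by rewrite -scalerBr opprD addrACA subrr add0r.
have zd k : rnorm (z k.+1 - z k) <= 2^-1 ^+ k.
  elim: k => [|k IH].
    by rewrite /= subr0 hn mulr0 addr0 expr0; lra.
  have -> : z k.+2 - z k.+1 = h *: (z k.+1 * z k.+1 - z k * z k) by exact: stepB.
  rewrite hn exprS; apply: ler_wpM2l; first by rewrite invr_ge0.
  apply: (le_trans (sqB _ _)); have := zn k.+1; have := zn k.
  have := rnorm_ge0 (z k.+1 - z k); have := rnorm_ge0 (z k); have := rnorm_ge0 (z k.+1).
  by nra.
have [l lz] := geometric_cvg zd.
have ln : rnorm l <= 1.
  have [|N HN] := lz 2^-1; first by rewrite invr_gt0.
  have := HN N (leqnn N); have := rnormD (l - z N) (z N); rewrite subrK.
  by have := zn N; lra.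
have lE E : closed_star_subalgebra E -> E x -> E l.
  move=> EP Ex; apply: (closed_rnorm (csub_closed EP)) => e /lz [N HN].
  exists (z N); last exact: HN.
  elim: N {HN} => [|N IH]; first exact: csub0.
  by apply: (csubZ EP); apply: (csubD EP) => //; apply: csubM.
have ls : adj l = l.
  apply/eqP; rewrite -subr_eq0; apply/eqP; apply: rnorm_small_eq0 => e e0.
  have [|N HN] := lz (e / 2); first by rewrite divr_gt0.
  have zs : adj (z N) = z N.
    elim: N {HN} => [|N IH]; first by rewrite /= adj0.
    by rewrite /= adjZ adjD adjM IH xs conj_Creal // complex_real.
  have -> : adj l - l = adj (l - z N) - (l - z N).
    by rewrite adjB zs opprB addrA subrK.
  apply: (le_lt_trans (rnormD _ _)); rewrite rnormN rnorm_adj.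
  by have := HN N (leqnn N); lra.
have lfix : l = h *: (x + l * l).
  apply/eqP; rewrite -subr_eq0; apply/eqP; apply: rnorm_small_eq0 => e e0.
  have [|N HN] := lz (e / 2); first by rewrite divr_gt0.
  have -> : l - h *: (x + l * l) = (l - z N.+1) + h *: (z N * z N - l * l).
    by rewrite -stepB addrA subrK.
  apply: (le_lt_trans (rnormD _ _)); rewrite hn.
  have := HN N.+1 (leqnSn N); have := HN N (leqnn N); have := sqB (z N) l.
  have := zn N; rewrite (rnormBC (z N) l).
  by have := rnorm_ge0 (l - z N); have := rnorm_ge0 l; have := rnorm_ge0 (z N); nra.
exists (1 - l); split.
- by rewrite adjB adj1 ls.
- have h2 : h + h = 1 by rewrite /h -rmorphD /=; congr (_ +i* _); lra.
  have l2 : l + l = x + l * l.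
    by rewrite {1 2}lfix -scalerDl h2 scale1r.
  rewrite mulrBl mul1r mulrBr mulr1 opprB [l * l - l]addrC addrA -[1 - l - l]addrA -opprD l2.
  by rewrite opprD addrA subrK.
- by move=> E EP Ex; apply: (csubB EP); [exact: csub1 | exact: lE].
Qed.

End FunctionalCalculus.

(** * Boundedness of homomorphisms and of traces *)

Section StarHom.
Context {R : realType} {A B : cstarAlgType R} (f : A -> B) (fP : star_hom f).
Implicit Types x y : A.

Lemma shom_lin (a : R[i]) x y : f (a *: x + y) = a *: f x + f y.
Proof. by case: fP. Qed.
Lemma shom1 : f 1 = 1. Proof. by case: fP. Qed.
Lemma shomM x y : f (x * y) = f x * f y. Proof. by case: fP. Qed.
Lemma shom_adj x : f (adj x) = adj (f x). Proof. by case: fP. Qed.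
Lemma shomD x y : f (x + y) = f x + f y.
Proof. by rewrite -[x in LHS]scale1r shom_lin scale1r. Qed.
Lemma shom0 : f 0 = 0.
Proof. by apply: (addrI (f 0)); rewrite -shomD !addr0. Qed.
Lemma shomZ (a : R[i]) x : f (a *: x) = a *: f x.
Proof. by rewrite -[a *: x]addr0 shom_lin shom0 addr0. Qed.
Lemma shomN x : f (- x) = - f x.
Proof. by rewrite -scaleN1r shomZ scaleN1r. Qed.
Lemma shomB x y : f (x - y) = f x - f y.
Proof. by rewrite shomD shomN. Qed.
Lemma shom_sum (I : Type) (r : seq I) (P : pred I) (g : I -> A) :
  f (\sum_(i <- r | P i) g i) = \sum_(i <- r | P i) f (g i).
Proof. by apply: big_morph; [exact: shomD | exact: shom0]. Qed.

(** When a and b are commuting selfadjoint elements with a ^+ 2 + b ^+ 2 = 1, a is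
    the real part of the unitary a + i b. *)
Lemma circle_rnorm (a b : B) : adj a = a -> adj b = b -> a * b = b * a ->
  a * a + b * b = 1 -> rnorm a <= 1.
Proof.
move=> sa sb ab sq.
pose v := a + 'i%R *: b.
have av : adj v = a - 'i%R *: b by rewrite adjD adjZ sa sb conjCi scaleNr.
have vn : rnorm v = 1.
  have : rnorm (adj v * v) = 1.
    rewrite av mulrDr !mulrBl -!scalerAl -!scalerAr !scalerA -(expr2 'i%R) sqrCi ab.
    by rewrite addrA subrK scaleN1r opprK sq rnorm1.
  rewrite rnorm_cstar => /eqP; rewrite sqrf_eq1 => /orP[/eqP //|/eqP vE].
  by have := rnorm_ge0 v; lra.
have -> : a = (2^-1)%:C *: (v + adj v).
  rewrite av addrACA subrr addr0 scalerDr -scalerDl -rmorphD /=.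
  by rewrite (_ : 2^-1 + 2^-1 = 1 :> R) ?scale1r //; lra.
rewrite rnormZ_real ?invr_ge0 //.
by have := rnormD v (adj v); rewrite rnorm_adj vn; lra.
Qed.

(** With y the square root of 1 - x ^+ 2, the images of x and y again satisfy the
    hypotheses of [circle_rnorm]. *)
Lemma shom_rnorm_sa x : adj x = x -> rnorm x <= 2^-1 -> rnorm (f x) <= 1.
Proof.
move=> xs xn.
have x2n : rnorm (x * x) <= 2^-1.
  by apply: (le_trans (rnormM _ _)); have := rnorm_ge0 x; nra.
have [|y [ys yy yE]] := sqrt_one_sub _ x2n; first by rewrite adjM xs.
have /= yx := yE _ (commutant_csub xs) (esym (mulrA x x x)).
apply: (@circle_rnorm _ (f y)); rewrite -?shom_adj ?xs ?ys -?shomM ?yx //.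
by rewrite -shomD yy addrC subrK shom1.
Qed.

(** The optimal constant is 1; 2 is what rescaling [shom_rnorm_sa] gives, and any
    constant makes homomorphisms continuous. *)
Lemma shom_rnorm x : rnorm (f x) <= 2 * rnorm x.
Proof.
have [/rnorm_eq0 ->|x0] := eqVneq (rnorm x) 0; first by rewrite shom0 !rnorm0 mulr0.
have x_gt0 : 0 < rnorm x by rewrite lt_def x0 rnorm_ge0.
pose c := (2 * rnorm x ^+ 2)^-1.
have c0 : 0 < c by rewrite invr_gt0 mulr_gt0 // exprn_gt0.
have cx : c * (2 * rnorm x ^+ 2) = 1 by rewrite mulVf // gt_eqF // -invr_gt0.
have := @shom_rnorm_sa (c%:C *: (adj x * x)).
rewrite adjZ adjM adjK conj_Creal ?complex_real // => /(_ erefl).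
rewrite shomZ shomM shom_adj !rnormZ_real ?(ltW c0) // !rnorm_cstar => H.
have {}H : c * rnorm (f x) ^+ 2 <= 1 by apply: H; lra.
rewrite -(@ler_pXn2r _ 2) ?nnegrE ?mulr_ge0 ?rnorm_ge0 //.
rewrite -(ler_pM2l c0); apply: (le_trans H); rewrite exprMn; nra.
Qed.

End StarHom.

Section Composition.
Context {R : realType} {A : cstarAlgType R}.

Lemma star_hom_comp (f g : A -> A) : star_hom f -> star_hom g -> star_hom (f \o g).
Proof.
move=> fP gP; split => /=.
- by move=> a x y; rewrite (shom_lin gP) (shom_lin fP).
- by rewrite (shom1 gP) (shom1 fP).
- by move=> x y; rewrite (shomM gP) (shomM fP).
- by move=> x; rewrite (shom_adj gP) (shom_adj fP).
Qed.

Lemma unitary_adj (w : A) : unitary_elt w -> unitary_elt (adj w).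
Proof. by move=> [w1 w2]; split; rewrite adjK. Qed.

Lemma Ad_hom (w : A) : unitary_elt w -> star_hom (Ad w).
Proof.
move=> [w1 w2]; split; rewrite /Ad.
- by move=> a x y; rewrite mulrDr mulrDl -scalerAr -scalerAl.
- by rewrite mulr1.
- by move=> x y; rewrite !mulrA -(mulrA _ (adj w) w) w1 mulr1.
- by move=> x; rewrite !adjM adjK mulrA.
Qed.

End Composition.

Section Trace.
Context {R : realType} {A : cstarAlgType R}.
Variables (F : set A) (FP : closed_star_subalgebra F).
Variables (tau : A -> R[i]) (tauP : normalized_trace F tau).
Implicit Types x y : A.

Lemma tr_lin (a : R[i]) x y : F x -> F y -> tau (a *: x + y) = a * tau x + tau y.
Proof. by case: tauP => + _ _ _; apply. Qed.
Lemma tr_ge0 x : F x -> 0 <= tau (adj x * x).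
Proof. by case: tauP => _ + _ _; apply. Qed.
Lemma tr1 : tau 1 = 1. Proof. by case: tauP. Qed.
Lemma trC x y : F x -> F y -> tau (x * y) = tau (y * x).
Proof. by case: tauP => _ _ _ +; apply. Qed.
Lemma trD x y : F x -> F y -> tau (x + y) = tau x + tau y.
Proof. by move=> Fx Fy; rewrite -[x in LHS]scale1r tr_lin // mul1r. Qed.
Lemma tr0 : tau 0 = 0.
Proof.
have F0 := csub0 FP.
by apply: (addrI (tau 0)); rewrite -trD // !addr0.
Qed.
Lemma trZ (a : R[i]) x : F x -> tau (a *: x) = a * tau x.
Proof. by move=> Fx; rewrite -[a *: x]addr0 tr_lin ?tr0 ?addr0 //; exact: csub0. Qed.
Lemma trN x : F x -> tau (- x) = - tau x.
Proof. by move=> Fx; rewrite -scaleN1r trZ // mulN1r. Qed.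
Lemma trB x y : F x -> F y -> tau (x - y) = tau x - tau y.
Proof. by move=> Fx Fy; rewrite trD ?trN //; exact: csubN. Qed.
Lemma tr_sum (I : Type) (r : seq I) (P : pred I) (g : I -> A) :
  (forall i, P i -> F (g i)) ->
  tau (\sum_(i <- r | P i) g i) = \sum_(i <- r | P i) tau (g i).
Proof.
move=> Fg; elim: r => [|i r IH]; first by rewrite !big_nil tr0.
rewrite !big_cons; case: ifP => // Pi; rewrite trD ?IH //; first exact: Fg.
exact: csub_sum.
Qed.

Lemma tr_proj_ge0 q : F q -> is_projection q -> 0 <= tau q.
Proof. by move=> Fq [qq qs]; have := tr_ge0 Fq; rewrite qs qq. Qed.

(** If y is the square root of 1 - b / (2 M), then q - q b q / (2 M) is
    adj (y q) * (y q), of nonnegative trace.  This is how operator inequalities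
    enter: only elements adj x * x with x in F are known to have trace >= 0. *)
Lemma tr_compress b q (M : R) : F b -> adj b = b -> F q -> is_projection q ->
  0 < M -> rnorm b <= M -> tau (q * b * q) <= (2 * M)%:C * tau q.
Proof.
move=> Fb bs Fq [qq qs] M0 bM.
pose c := (2 * M)^-1.
have M2 : 0 < 2 * M by lra.
have c0 : 0 < c by rewrite invr_gt0.
have cM : c * (2 * M) = 1 by rewrite mulVf // gt_eqF.
have [||y [ys yy yE]] := @sqrt_one_sub _ _ (c%:C *: b).
- by rewrite adjZ bs conj_Creal // complex_real.
- by rewrite rnormZ_real ?(ltW c0) //; nra.
have Fy : F y by apply: yE => //; apply: csubZ.
have := tr_ge0 (csubM FP Fy Fq); rewrite adjM qs ys mulrA -(mulrA q) yy.
rewrite mulrBr mulrBl mulr1 qq -scalerAr -scalerAl.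
have Fqbq : F (q * b * q) by do 2 apply: csubM => //.
rewrite trB ?trZ //; last exact: csubZ.
rewrite subr_ge0 => H.
have : (2 * M)%:C * (c%:C * tau (q * b * q)) <= (2 * M)%:C * tau q.
  by apply: ler_wpM2l => //; rewrite ler0c ltW.
by rewrite mulrA -rmorphM /= mulrC [_ * c]mulrC cM mulr1.
Qed.

(** The case q = 1 of [tr_compress], for x and for - x. *)
Lemma tr_bound_sa x (c : R) : F x -> adj x = x -> 0 < c -> rnorm x <= c ->
  `|tau x| <= (2 * c)%:C.
Proof.
move=> Fx xs c0 xc.
have F1 := csub1 FP.
have p1 : is_projection (1 : A) by split; rewrite ?mulr1 ?adj1.
have up y : F y -> adj y = y -> rnorm y <= c -> tau y <= (2 * c)%:C.
  by move=> Fy ys yc; have := tr_compress Fy ys F1 p1 c0 yc; rewrite tr1 mul1r !mulr1.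
have xr : tau x \is Num.real.
  by rewrite (ler_real (up _ Fx xs xc)) complex_real.
rewrite real_ler_norml // up // andbT lerNl -trN // up ?rnormN ?adjN ?xs //.
exact: csubN.
Qed.

(** Split x into its real and imaginary parts. *)
Lemma tr_bound x (c : R) : F x -> 0 < c -> rnorm x <= c -> `|tau x| <= (4 * c)%:C.
Proof.
move=> Fx c0 xc.
pose h : R[i] := (2^-1)%:C.
have hc : Num.conj h = h by rewrite conj_Creal // complex_real.
have hn (z : A) : rnorm (h *: z) = 2^-1 * rnorm z by rewrite /h rnormZ_real ?invr_ge0.
have h2 : h + h = 1 by rewrite /h -rmorphD /=; congr (_ +i* _); lra.
pose a := h *: (x + adj x); pose b := (- 'i%R * h) *: (x - adj x).
have Fxs : F (adj x) by apply: csub_adj.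
have Fa : F a by apply: (csubZ FP); apply: (csubD FP).
have Fb : F b by apply: (csubZ FP); apply: (csubB FP).
have xE : x = 'i%R *: b + a.
  rewrite /a /b scalerA mulrA mulrN -expr2 sqrCi opprK mul1r -scalerDr addrACA.
  by rewrite addNr addr0 scalerDr -scalerDl h2 scale1r.
rewrite xE tr_lin //; apply: (le_trans (ler_normD _ _)).
rewrite normrM normCi mul1r.
have -> : (4 * c)%:C = (2 * c)%:C + (2 * c)%:C :> R[i].
  by rewrite -rmorphD /=; congr (_ +i* _); lra.
apply: lerD; apply: tr_bound_sa => //.
- by rewrite /b adjZ adjB adjK rmorphM rmorphN /= conjCi hc opprK mulNr scaleNr -scalerN opprB.
- rewrite /b rnormZ normrM normrN normCi mul1r.
  rewrite -rnormZ hn; have := rnormD x (- adj x); rewrite rnormN rnorm_adj; lra.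
- by rewrite /a adjZ adjD adjK hc addrC.
- by rewrite /a hn; have := rnormD x (adj x); rewrite rnorm_adj; lra.
Qed.

(** [tr_compress] for b = p - a and q = p: tau (p - a) <= tau p / 2. *)
Lemma tr_close_le p a : F p -> F a -> is_projection p -> adj a = a ->
  p * a * p = a -> rnorm (p - a) <= 4^-1 -> tau p <= 2 * tau a.
Proof.
move=> Fp Fa pP asa pap pa.
have Fd : F (p - a) by apply: csubB.
have := @tr_compress (p - a) p 4^-1 Fd _ Fp pP _ pa.
have [pp ps] := pP; rewrite adjB asa ps => /(_ erefl) H.
have {H} : tau (p * (p - a) * p) <= (2 * 4^-1)%:C * tau p by apply: H; lra.
rewrite mulrBr mulrBl pp pp pap trB //.
have -> : 2 * 4^-1 = 2^-1 :> R by lra.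
rewrite lerBlDl -lerBlDr => H.
have h2 : 2 * (2^-1)%:C = 1 :> R[i].
  by rewrite mulr_natl mulr2n -rmorphD /=; congr (_ +i* _); lra.
have -> : tau p = 2 * (tau p - (2^-1)%:C * tau p); last by rewrite ler_pM2l.
by rewrite mulrBr mulrA h2 mul1r mulr_natl mulr2n addrK.
Qed.

End Trace.

(** * Roots of unity, and the extreme point 1 *)

Section RootsOfUnity.
Context {R : realType}.

Lemma prim_root_ex (N : nat) : (0 < N)%N -> exists z : R[i], N.-primitive_root z.
Proof.
move=> N0; pose p : {poly R[i]} := 'X^N - 1.
have [r Dp] := closed_field_poly_normal p.
rewrite (monicP _) ?monicXnsubC // scale1r in Dp.
have rn1 : all N.-unity_root r by apply/allP => z; rewrite -root_prod_XsubC -Dp.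
have sz_r : (N < (size r).+1)%N.
  by rewrite -(size_prod_XsubC r id) -Dp size_XnsubC.
have [|z _ zN] := hasP (has_prim_root N0 rn1 _ sz_r); last by exists z.
by rewrite -separable_prod_XsubC -Dp separable_Xn_sub_1 // pnatr_eq0 -lt0n.
Qed.

Lemma prim_root_norm N (z : R[i]) : N.-primitive_root z -> `|z| = 1.
Proof.
move=> zN; apply/eqP; rewrite -(@pexpr_eq1 _ _ N) ?(prim_order_gt0 zN) //.
by rewrite -normrX (prim_expr_order zN) normr1.
Qed.

Lemma conj_unit (z : R[i]) : `|z| = 1 -> z * Num.conj z = 1.
Proof. by move=> z1; rewrite -normCK z1 expr1n. Qed.

(** Orthogonality of the characters of the cyclic group of order N. *)
Lemma prim_root_orth N (z : R[i]) (d e : nat) : N.-primitive_root z ->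
  (d < N)%N -> (e < N)%N ->
  \sum_(j < N) (z ^+ j) ^+ d * Num.conj (z ^+ j) ^+ e = (d == e)%:R * N%:R.
Proof.
move=> zN dN eN; have z1 := conj_unit (prim_root_norm zN).
pose t := z ^+ d * Num.conj z ^+ e.
under eq_bigr => j _.
  rewrite rmorphXn /= -!exprM ![(j * _)%N]mulnC !exprM -exprMn -/t; over.
have [de|de] := eqVneq d e.
  rewrite mul1r (_ : t = 1) ?/t ?de -?exprMn ?z1 ?expr1n //.
  by under eq_bigr do rewrite expr1n; rewrite sumr_const card_ord.
rewrite mul0r; have t1 : t != 1.
  apply: contra de => /eqP t1.
  rewrite -(modn_small dN) -(modn_small eN) -(eq_prim_root_expr zN).
  rewrite -[X in X == _]mulr1 -(expr1n _ e) -z1 exprMn [_ ^+ e * _]mulrC mulrA.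
  by rewrite -/t t1 mul1r.
apply/eqP; move: t1; rewrite -subr_eq0 => t1; rewrite -(mulrI_eq0 _ (mulfI t1)).
rewrite -subrX1 /t exprMn -!exprM ![(_ * N)%N]mulnC !exprM -rmorphXn /=.
by rewrite (prim_expr_order zN) rmorph1 !expr1n mul1r subrr.
Qed.

End RootsOfUnity.

Section Vertex.
Context {R : realType} {A : cstarAlgType R}.
Implicit Types x y c : A.

Lemma rnorm_prod_le1 x y : rnorm x <= 1 -> rnorm y <= 1 -> rnorm (x * y) <= 1.
Proof.
move=> x1 y1; apply: (le_trans (rnormM _ _)).
by have := rnorm_ge0 x; have := rnorm_ge0 y; nra.
Qed.

Lemma rnormX_le1 x k : rnorm x <= 1 -> rnorm (x ^+ k) <= 1.
Proof.
by move=> x1; elim: k => [|k IH]; rewrite ?exprS ?rnorm1 // rnorm_prod_le1.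
Qed.

Lemma rnorm_convex (t : R) x y : 0 <= t <= 1 -> rnorm x <= 1 -> rnorm y <= 1 ->
  rnorm (t%:C *: x + (1 - t)%:C *: y) <= 1.
Proof.
move=> /andP[t0 t1] x1 y1; apply: (le_trans (rnormD _ _)).
rewrite !rnormZ_real ?subr_ge0 //.
by have := rnorm_ge0 x; have := rnorm_ge0 y; nra.
Qed.

(** 1 + t c is a convex combination of 1 + c and 1 - c for real t in [-1, 1].  For
    1 + i t c use the C*-identity: 1 + (t c) ^+ 2 is the mean of the squares of
    1 + t c and 1 - t c.  For z = x + i y on the circle, 1 + (z / 2) c is the
    midpoint of 1 + x c and 1 + i y c. *)
Lemma rnorm_vertex_circle c (z : R[i]) : adj c = c -> rnorm (1 + c) <= 1 ->
  rnorm (1 - c) <= 1 -> `|z| = 1 -> rnorm (1 + (z / 2) *: c) <= 1.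
Proof.
move=> cs cp cm z1.
have h2 : (2^-1)%:C + (2^-1)%:C = 1 :> R[i].
  by rewrite -rmorphD /=; congr (_ +i* _); lra.
have real_le1 (t : R) : `|t| <= 1 -> rnorm (1 + t%:C *: c) <= 1.
  rewrite ler_norml => /andP[t0 t1].
  have -> : 1 + t%:C *: c = ((1 + t) / 2)%:C *: (1 + c) + (1 - (1 + t) / 2)%:C *: (1 - c).
    have s1 : ((1 + t) / 2)%:C + (1 - (1 + t) / 2)%:C = 1 :> R[i].
      by rewrite -rmorphD /=; congr (_ +i* _); lra.
    have s2 : ((1 + t) / 2)%:C - (1 - (1 + t) / 2)%:C = t%:C :> R[i].
      by rewrite -rmorphB /=; congr (_ +i* _); lra.
    by rewrite !scalerDr addrACA -scalerDl s1 scale1r scalerN -scalerBl s2.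
  by apply: rnorm_convex => //; apply/andP; split; lra.
have imag_le1 (t : R) : `|t| <= 1 -> rnorm (1 + ('i%R * t%:C) *: c) <= 1.
  move=> t1; rewrite -(@ler_pXn2r _ 2) ?nnegrE ?rnorm_ge0 // expr1n -rnorm_cstar.
  set g := t%:C *: c.
  have gs : adj g = g by rewrite /g adjZ cs conj_Creal // complex_real.
  rewrite -scalerA -/g adjD adj1 adjZ gs conjCi scaleNr.
  have sq1 : (1 - 'i%R *: g) * (1 + 'i%R *: g) = 1 + g * g.
    rewrite mulrDr mulr1 mulrBl mul1r addrA subrK -scalerAl -scalerAr scalerA.
    by rewrite -(expr2 'i%R) sqrCi scaleN1r opprK.
  have sq2 : (1 + g) * (1 + g) + (1 - g) * (1 - g) = (1 + g * g) + (1 + g * g).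
    have -> : (1 + g) * (1 + g) = 1 + g + (g + g * g) by rewrite mulrDl mul1r mulrDr mulr1.
    have -> : (1 - g) * (1 - g) = 1 - g + (- g + g * g).
      by rewrite mulrBl mul1r mulrBr mulr1 opprB [g * g - g]addrC.
    by rewrite addrACA (addrACA 1 g 1) subrr addr0 (addrACA g) subrr add0r addrACA.
  have -> : (1 - 'i%R *: g) * (1 + 'i%R *: g)
     = (2^-1)%:C *: ((1 + g) * (1 + g)) + (1 - 2^-1)%:C *: ((1 - g) * (1 - g)).
    have -> : 1 - 2^-1 = 2^-1 :> R by lra.
    by rewrite -scalerDr sq2 sq1 scalerDr -scalerDl h2 scale1r.
  apply: rnorm_convex; first by apply/andP; split; lra.
    by apply: rnorm_prod_le1; exact: real_le1.
  have -> : 1 - g = 1 + (- t)%:C *: c by rewrite rmorphN scaleNr.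
  by apply: rnorm_prod_le1; apply: real_le1; rewrite normrN.
have z_re : `|complex.Re z| <= 1 by rewrite -lecR -[leRHS]z1 normc_ge_Re.
have z_im : `|complex.Im z| <= 1.
  rewrite -lecR -[leRHS]z1 -[leRHS]mulr1 -normCi -normrM -normrN -ReiNIm -complexiE.
  exact: normc_ge_Re.
have -> : 1 + (z / 2) *: c = (2^-1)%:C *: (1 + (complex.Re z)%:C *: c)
   + (1 - 2^-1)%:C *: (1 + ('i%R * (complex.Im z)%:C) *: c).
  have -> : 1 - 2^-1 = 2^-1 :> R by lra.
  rewrite -scalerDr addrACA -scalerDl -complexiE -complexE scalerDr scalerDr -scalerDl.
  rewrite h2 scale1r scalerA mulrC; congr (1 + (_ * _) *: c).
  by apply: (mulfI (_ : 2 != 0 :> R[i])) => //; rewrite mulfV // mulr_natl mulr2n h2.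
apply: rnorm_convex; [by apply/andP; split; lra | exact: real_le1 | exact: imag_le1].
Qed.

(** 1 is an extreme point of the unit ball, at least in selfadjoint directions.  The
    powers f_z = (1 + (z / 2) c) ^+ k all have norm at most 1 on the circle, and
    their coefficient at z is (k / 2) c.  Cauchy's estimate, with the mean over the
    roots of unity of order k + 1 for the integral, bounds (k / 2) norm c by 1 for
    every k. *)
Lemma rnorm_vertex c : adj c = c -> rnorm (1 + c) <= 1 -> rnorm (1 - c) <= 1 -> c = 0.
Proof.
move=> cs cp cm; apply: rnorm_small_eq0 => e e0.
have [k ke] : exists k : nat, 2 / e < k%:R.
  by exists (Num.truncn (2 / e)).+1; rewrite truncnS_gt // divr_ge0 // ltW.
suff kc : k%:R * rnorm c <= 2.
  rewrite ltr_pdivrMr // in ke; rewrite ltNge; apply/negP => ce.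
  by have := rnorm_ge0 c; have : 0 <= (k%:R : R) by []; nra.
have k0 : (0 < k)%N by rewrite lt0n; apply: contraTneq ke => ->; rewrite -leNgt divr_ge0 // ltW.
have [z zN] := @prim_root_ex R k.+1 isT.
pose f (j : 'I_k.+1) : A := (1 + (z ^+ j / 2) *: c) ^+ k.
have fn j : rnorm (f j) <= 1.
  apply: rnormX_le1; apply: rnorm_vertex_circle => //.
  by rewrite normrX (prim_root_norm zN) expr1n.
have sumE : \sum_(j < k.+1) Num.conj (z ^+ j) *: f j = (k.+1%:R * (k%:R / 2)) *: c.
  pose g := (2^-1 : R[i]) *: c.
  have fE (j : 'I_k.+1) : Num.conj (z ^+ j) *: f j =
      \sum_(l < k.+1) ((z ^+ j) ^+ l * Num.conj (z ^+ j) ^+ 1) *: (g ^+ l *+ 'C(k, l)).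
    rewrite /f exprDn_comm; last by apply/commr_sym/commr1.
    rewrite scaler_sumr; apply: eq_bigr => l _.
    by rewrite expr1n mul1r -scalerA exprZn -!scalerMnr scalerA mulrC expr1.
  rewrite (eq_bigr _ (fun j _ => fE j)) exchange_big /=.
  have k1 : (1 < k.+1)%N by [].
  under eq_bigr => l _ do rewrite -scaler_suml (prim_root_orth zN (ltn_ord l) k1).
  rewrite (bigD1 (Ordinal k1)) //= big1 ?addr0 => [|l l1].
    by rewrite mul1r bin1 [g ^+ _]expr1 -(scaler_nat _ g) /g !scalerA mulrA.
  by rewrite (_ : (l == 1%N :> nat) = false) ?mul0r ?scale0r //; apply/negbTE.
have : rnorm (\sum_(j < k.+1) Num.conj (z ^+ j) *: f j) <= k.+1%:R.
  apply: (le_trans (rnorm_sum _ _ _)).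
  rewrite -[k.+1 in leRHS]card_ord -sumr_const; apply: ler_sum => j _.
  by rewrite rnormZ_unit // norm_conjC normrX (prim_root_norm zN) expr1n.
rewrite sumE rnormZ.
have -> : k.+1%:R * (k%:R / 2) = (k.+1%:R * (k%:R / 2))%:C :> R[i].
  by rewrite !rmorphM fmorphV !rmorph_nat.
rewrite ger0_norm ?ler0c ?mulr_ge0 ?invr_ge0 //= -mulrA ger_pMr ?ltr0Sn // => kc.
by lra.
Qed.

End Vertex.

(** * Closed linear spans *)

Section Span.
Context {R : realType} {A : cstarAlgType R}.
Implicit Types (x y : A) (G E : set A).

Lemma lin_span_ind G (P : A -> Prop) :
  P 0 -> (forall (a : R[i]) x y, G x -> P y -> P (a *: x + y)) ->
  forall x, lin_span G x -> P x.
Proof.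
move=> P0 PD x [m [c [e [Ge ->]]]].
elim/big_rec: _ => // i y _ Py; exact: PD.
Qed.

Lemma lin_span0 G : lin_span G 0.
Proof. by exists 0, (fun _ => 0), (fun _ => 0); split => [[]//|]; rewrite big_ord0. Qed.

Lemma lin_span_cons G (a : R[i]) x y : G x -> lin_span G y -> lin_span G (a *: x + y).
Proof.
move=> Gx [m [c [e [Ge ->]]]].
exists m.+1, (fun k => oapp c a (unlift ord0 k)), (fun k => oapp e x (unlift ord0 k)).
split=> [k|]; first by case: (unlift ord0 k) => [i|] /=.
by rewrite big_ord_recl unlift_none /=; congr (_ + _); apply: eq_bigr => i _; rewrite liftK.
Qed.

Lemma lin_span_gen G x : G x -> lin_span G x.
Proof. by move=> Gx; have := lin_span_cons 1 Gx (lin_span0 G); rewrite scale1r addr0. Qed.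

Lemma lin_spanD G x y : lin_span G x -> lin_span G y -> lin_span G (x + y).
Proof.
move=> Gx Gy; elim/lin_span_ind: x / Gx => [|a x z Gx IH]; first by rewrite add0r.
by rewrite -addrA; apply: lin_span_cons.
Qed.

Lemma lin_spanZ G (b : R[i]) x : lin_span G x -> lin_span G (b *: x).
Proof.
elim/lin_span_ind => [|a y z Gy IH]; first by rewrite scaler0; exact: lin_span0.
by rewrite scalerDr scalerA; apply: lin_span_cons.
Qed.

Lemma closed_lin_span_gen G x : G x -> closed_lin_span G x.
Proof. by move=> Gx; apply: subset_closure; exact: lin_span_gen. Qed.

Lemma closed_lin_span_sub G E : closed_star_subalgebra E -> G `<=` E ->
  closed_lin_span G `<=` E.
Proof.
move=> EP GE x /closure_rnormP Gx; apply: (closed_rnorm (csub_closed EP)) => e /Gx.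
case=> y Gy xy; exists y => //; elim/lin_span_ind: y / Gy {xy} => [|a y z Gy Ez].
  exact: csub0.
by apply: csub_lin => //; exact: GE.
Qed.

Lemma closed_lin_span_csub G : G 1 -> (forall x, G x -> G (adj x)) ->
  (forall x y, G x -> G y -> lin_span G (x * y)) ->
  closed_star_subalgebra (closed_lin_span G).
Proof.
move=> G1 Ga GM.
have LM x y : lin_span G x -> lin_span G y -> lin_span G (x * y).
  elim/lin_span_ind => [|a x' z Gx IH] Gy; first by rewrite mul0r; exact: lin_span0.
  rewrite mulrDl -scalerAl; apply: lin_spanD; last exact: IH.
  apply: lin_spanZ; elim/lin_span_ind: y / Gy {IH} => [|b y t Gy IH].
    by rewrite mulr0; exact: lin_span0.
  by rewrite mulrDr -scalerAr; apply: lin_spanD => //; apply: lin_spanZ; exact: GM.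
have La x : lin_span G x -> lin_span G (adj x).
  elim/lin_span_ind => [|a y z Gy IH]; first by rewrite adj0; exact: lin_span0.
  by rewrite adjD adjZ; apply: lin_span_cons => //; exact: Ga.
split.
- exact: closed_lin_span_gen.
- move=> a x y /closure_rnormP Gx /closure_rnormP Gy; apply/closure_rnormP => e e0.
  pose t := complex.Re `|a| + 1.
  have ta : 0 <= complex.Re `|a| by rewrite -ler0c RRe_real ?ger0_real.
  have t0 : 0 < t by rewrite /t; lra.
  have [|x' Gx' xx] := Gx (e / 2 / t); first by rewrite !divr_gt0.
  have [|y' Gy' yy] := Gy (e / 2); first by rewrite divr_gt0.
  exists (a *: x' + y'); first by apply: lin_spanD => //; exact: lin_spanZ.
  rewrite opprD addrACA -scalerBr; apply: (le_lt_trans (rnormD _ _)); rewrite rnormZ.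
  move: xx; rewrite ltr_pdivlMr // => xx.
  by have := rnorm_ge0 (x - x'); rewrite /t in xx; nra.
- move=> x y /closure_rnormP Gx /closure_rnormP Gy; apply/closure_rnormP => e e0.
  pose t := rnorm x + 1; have x0 := rnorm_ge0 x.
  have t0 : 0 < t by rewrite /t; lra.
  have [|y' Gy' yy] := Gy (e / 2 / t); first by rewrite !divr_gt0.
  pose s := rnorm y' + 1; have y0 := rnorm_ge0 y'.
  have s0 : 0 < s by rewrite /s; lra.
  have [|x' Gx' xx] := Gx (e / 2 / s); first by rewrite !divr_gt0.
  exists (x' * y'); first exact: LM.
  have -> : x * y - x' * y' = x * (y - y') + (x - x') * y'.
    by rewrite mulrBr mulrBl addrA subrK.
  apply: (le_lt_trans (rnormD _ _)).
  apply: (le_lt_trans (lerD (rnormM _ _) (rnormM _ _))).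
  move: xx yy; rewrite !ltr_pdivlMr // /t /s => xx yy.
  by have := rnorm_ge0 (x - x'); have := rnorm_ge0 (y - y'); nra.
- move=> x /closure_rnormP Gx; apply/closure_rnormP => e /Gx [x' Gx' xx].
  by exists (adj x'); [exact: La | rewrite -adjB rnorm_adj].
- exact: closed_closure.
Qed.

End Span.

Section StarHomSubalgebra.
Context {R : realType} {A B : cstarAlgType R}.

Lemma preimage_csub (f : A -> B) (E : set B) : star_hom f ->
  closed_star_subalgebra E -> closed_star_subalgebra [set x | E (f x)].
Proof.
move=> fP EP; split => /=.
- by rewrite (shom1 fP); exact: csub1.
- by move=> a x y Ex Ey; rewrite (shom_lin fP); exact: csub_lin.
- by move=> x y Ex Ey; rewrite (shomM fP); exact: csubM.
- by move=> x Ex; rewrite (shom_adj fP); exact: csub_adj.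
apply: closed_of_rnorm => x H /=; apply: (closed_rnorm (csub_closed EP)) => e e0.
have [|y Ey xy] := H (e / 2); first by rewrite divr_gt0.
exists (f y) => //; rewrite -(shomB fP); apply: (le_lt_trans (shom_rnorm fP _)); lra.
Qed.

Lemma fixed_csub (f : A -> A) : star_hom f -> closed_star_subalgebra [set x | f x = x].
Proof.
move=> fP; split => /=.
- by rewrite (shom1 fP).
- by move=> a x y Ex Ey; rewrite (shom_lin fP) Ex Ey.
- by move=> x y Ex Ey; rewrite (shomM fP) Ex Ey.
- by move=> x Ex; rewrite (shom_adj fP) Ex.
apply: closed_of_rnorm => x H /=; apply/eqP; rewrite -subr_eq0; apply/eqP.
apply: rnorm_small_eq0 => e e0.
have [|y /= Ey xy] := H (e / 3); first by rewrite divr_gt0.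
have -> : f x - x = f (x - y) - (x - y) by rewrite (shomB fP) Ey opprB addrA subrK.
apply: (le_lt_trans (rnormD _ _)); rewrite rnormN.
by have := shom_rnorm fP (x - y); lra.
Qed.

Lemma csub_forall (I : Type) (P : I -> Prop) (E : I -> set A) :
  (forall i, P i -> closed_star_subalgebra (E i)) ->
  closed_star_subalgebra [set x | forall i, P i -> E i x].
Proof.
move=> EP; split => /=.
- by move=> i /EP; exact: csub1.
- by move=> a x y Ex Ey i Pi; apply: (csub_lin (EP _ Pi)); [exact: Ex | exact: Ey].
- by move=> x y Ex Ey i Pi; apply: (csubM (EP _ Pi)); [exact: Ex | exact: Ey].
- by move=> x Ex i Pi; apply: (csub_adj (EP _ Pi)); exact: Ex.
apply: closed_of_rnorm => x H i Pi; apply: (closed_rnorm (csub_closed (EP _ Pi))).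
by move=> e /H [y Ey xy]; exists y => //; exact: Ey.
Qed.

End StarHomSubalgebra.

(** * Words in the Cuntz isometries *)

Section CuntzRelations.
Context {R : realType} {A : cstarAlgType R} {n : nat} (S : 'I_n -> A).
Hypothesis Sf : cuntz_family S.

Lemma cuntz_iso i : adj (S i) * S i = 1. Proof. by case: Sf. Qed.
Lemma cuntz_sum : \sum_i S i * adj (S i) = 1. Proof. by case: Sf. Qed.

Lemma cuntz_rnorm i : rnorm (S i) <= 1.
Proof.
have := rnorm_cstar (S i); rewrite cuntz_iso rnorm1.
by have := rnorm_ge0 (S i); nra.
Qed.

(** Put a_k = adj S_j S_k adj S_k S_j.  The a_k add up to 1 and a_j = 1, so the
    others add up to 0; each is positive in the sense that norm (1 - a_k) <= 1.
    Hence a_i, being minus the sum of the remaining ones, is small on both sides: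
    norm (1 + r a_i) and norm (1 - r a_i) are at most 1 for r = 1 / (m + 2), with m
    the number of remaining indices.  By [rnorm_vertex], a_i = 0, and a_i is
    adj x * x for x = adj S_i * S_j. *)
Lemma cuntz_orth i j : i != j -> adj (S i) * S j = 0.
Proof.
move=> ij.
pose a k := adj (S j) * (S k * adj (S k)) * S j.
have as_ k : adj (a k) = a k by rewrite /a !adjM !adjK !mulrA.
have an k : rnorm (1 - a k) <= 1.
  have -> : 1 - a k = adj (S j) * (1 - S k * adj (S k)) * S j.
    by rewrite mulrBr mulr1 mulrBl cuntz_iso.
  have pk : is_projection (S k * adj (S k)).
    by split; rewrite ?adjM ?adjK // mulrA -[S k * _ * S k]mulrA cuntz_iso mulr1.
  have := rnorm_proj_le1 (proj_compl pk) => p1.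
  apply: rnorm_prod_le1; last exact: cuntz_rnorm.
  by apply: rnorm_prod_le1 => //; rewrite rnorm_adj; exact: cuntz_rnorm.
have asum : \sum_k a k = 1.
  by rewrite /a -mulr_suml -mulr_sumr cuntz_sum mulr1 cuntz_iso.
have aj : a j = 1 by rewrite /a mulrA cuntz_iso mul1r cuntz_iso.
have arest : a i = - \sum_(k | (k != j) && (k != i)) a k.
  move: asum; rewrite (bigD1 j) //= aj => /(congr1 (fun t => - 1 + t)).
  rewrite addKr addNr (bigD1 i) //= => /eqP; rewrite addr_eq0 => /eqP -> //.
pose m := #|[pred k | (k != j) && (k != i)]|.
pose r : R := (m.+2%:R)^-1.
have r0 : 0 < r by rewrite invr_gt0 ltr0n.
have rm : r * (m%:R + 2) = 1.
  by rewrite -natrD addn2 mulVf // pnatr_eq0.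
have srm : 2 * r + r * m%:R = 1 by rewrite [2 * r]mulrC -mulrDr addrC.
have m0 : 0 <= m%:R :> R by [].
have c0 : r%:C *: a i = 0.
  apply: rnorm_vertex.
  - by rewrite adjZ as_ conj_Creal // complex_real.
  - have -> : 1 + r%:C *: a i =
        (2 * r)%:C *: 1 + r%:C *: (\sum_(k | (k != j) && (k != i)) (1 - a k)).
      rewrite sumrB sumr_const -/m -arest scalerDr addrA -(scaler_nat m 1) scalerA.
      by rewrite -(rmorph_nat (real_complex R)) -rmorphM -scalerDl -rmorphD /= srm scale1r.
    apply: (le_trans (rnormD _ _)); rewrite !rnormZ_real ?rnorm1 ?mulr_ge0 ?(ltW r0) //.
    rewrite mulr1 -[leRHS]srm lerD2l ler_pM2l //.
    apply: (le_trans (rnorm_sum _ _ _)); rewrite -[leRHS]/(1 *+ m) -sumr_const.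
    by apply: ler_sum.
  - have -> : 1 - r%:C *: a i = (1 - r)%:C *: 1 + r%:C *: (1 - a i).
      by rewrite rmorphB /= rmorph1 scalerBl scale1r scalerBr addrA subrK.
    apply: (le_trans (rnormD _ _)); rewrite !rnormZ_real ?rnorm1 ?(ltW r0) //; last nra.
    by have := an i; have := rnorm_ge0 (1 - a i); nra.
have ai0 : a i = 0.
  move/eqP: c0; rewrite scaler_eq0 => /orP[|/eqP //].
  by rewrite -[_ == 0]/(_ == 0%:C) (inj_eq (@complexI _)) gt_eqF.
apply: rnorm_eq0; apply/eqP; rewrite -sqrf_eq0 -rnorm_cstar.
by rewrite adjM adjK mulrA -(mulrA (adj (S j))) -/(a i) ai0 rnorm0.
Qed.

End CuntzRelations.

Section Words.
Context {R : realType} {A : cstarAlgType R} {n : nat} (S : 'I_n -> A).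
Hypothesis Sf : cuntz_family S.
Local Notation W := (S_word S).
Implicit Types mu nu al be g : word (n := n).

Lemma word_nil : W [::] = 1. Proof. by rewrite /S_word big_nil. Qed.
Lemma word_cons i mu : W (i :: mu) = S i * W mu.
Proof. by rewrite /S_word big_cons. Qed.
Lemma word_cat mu nu : W (mu ++ nu) = W mu * W nu.
Proof. by rewrite /S_word big_cat. Qed.
Lemma word_rcons mu i : W (rcons mu i) = W mu * S i.
Proof. by rewrite -cats1 word_cat word_cons word_nil mulr1. Qed.

Lemma word_iso mu : adj (W mu) * W mu = 1.
Proof.
elim: mu => [|i mu IH]; first by rewrite word_nil adj1 mulr1.
by rewrite word_cons adjM mulrA -(mulrA _ _ (S i)) (cuntz_iso Sf) mulr1.
Qed.

Lemma word_rnorm mu : rnorm (W mu) <= 1.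
Proof.
have := rnorm_cstar (W mu); rewrite word_iso rnorm1.
by have := rnorm_ge0 (W mu); nra.
Qed.

(** The two words either differ at some letter, or one is a prefix of the other. *)
Lemma word_mul nu al : [\/ adj (W nu) * W al = 0,
  exists2 g, al = nu ++ g & adj (W nu) * W al = W g |
  exists2 g, nu = al ++ g & adj (W nu) * W al = adj (W g)].
Proof.
elim: nu al => [|i nu IH] [|j al].
- by constructor 2; exists [::] => //; rewrite word_nil adj1 mulr1.
- by constructor 2; exists (j :: al) => //; rewrite word_nil adj1 mul1r.
- by constructor 3; exists (i :: nu) => //; rewrite word_nil mulr1.
have -> : adj (W (i :: nu)) * W (j :: al) = adj (W nu) * (adj (S i) * S j) * W al.
  by rewrite !word_cons adjM !mulrA.
have [<-|ij] := eqVneq i j; last first.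
  by constructor 1; rewrite (cuntz_orth Sf ij) mulr0 mul0r.
rewrite (cuntz_iso Sf) mulr1; case: (IH al) => [->|[g -> ->]|[g -> ->]].
- by constructor 1.
- by constructor 2; exists g.
- by constructor 3; exists g.
Qed.

Lemma word_orth mu nu : size mu = size nu -> adj (W mu) * W nu = (mu == nu)%:R.
Proof.
move=> s; have [->|mn] := eqVneq mu nu; first exact: word_iso.
case: (word_mul mu nu) => [//|[g E _]|[g E _]]; move: s mn; rewrite E size_cat.
  rewrite -[LHS]addn0 => /addnI/esym/size0nil ->.
  by rewrite cats0 eqxx.
rewrite -[RHS]addn0 => /addnI/size0nil ->.
by rewrite cats0 eqxx.
Qed.

Lemma word_mul_word mu nu al be :
  W mu * adj (W nu) * (W al * adj (W be)) = 0 \/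
  exists g h, W mu * adj (W nu) * (W al * adj (W be)) = W g * adj (W h).
Proof.
have -> : W mu * adj (W nu) * (W al * adj (W be))
   = W mu * (adj (W nu) * W al) * adj (W be) by rewrite !mulrA.
case: (word_mul nu al) => [->|[g E ->]|[g E ->]].
- by left; rewrite mulr0 mul0r.
- by right; exists (mu ++ g), be; rewrite word_cat.
- by right; exists mu, (be ++ g); rewrite word_cat adjM mulrA.
Qed.

Definition star_word_set : set A :=
  [set x | exists mu nu, x = W mu * adj (W nu)].

Lemma star_word_csub : closed_star_subalgebra (closed_lin_span star_word_set).
Proof.
apply: closed_lin_span_csub.
- by exists [::], [::]; rewrite word_nil adj1 mulr1.
- by move=> x [mu [nu ->]]; exists nu, mu; rewrite adjM adjK.
move=> x y [mu [nu ->]] [al [be ->]].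
case: (word_mul_word mu nu al be) => [->|[g [h ->]]]; first exact: lin_span0.
by apply: lin_span_gen; exists g, h.
Qed.

End Words.

(** * The gauge action and the core *)

Section Gauge.
Context {R : realType} {A : cstarAlgType R} {n : nat} (S : 'I_n -> A).
Hypothesis SC : is_cuntz_algebra S.
Local Notation W := (S_word S).
Let Sf : cuntz_family S. Proof. by case: SC. Qed.

Lemma cuntz_dense (x : A) (e : R) : 0 < e ->
  exists2 y, lin_span (star_word_set S) y & rnorm (x - y) < e.
Proof.
have [_ gen _] := SC.
suff : closed_lin_span (star_word_set S) x by move=> /closure_rnormP; apply.
rewrite (gen _ (star_word_csub Sf)) // => i.
apply: closed_lin_span_gen; exists [:: i], [::].
by rewrite word_cons !word_nil adj1 !mulr1.
Qed.

(** The gauge automorphism of z when z has modulus 1: it multiplies each S_i by z. *)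
Definition gauge (z : R[i]) : A -> A := cuntz_endo S z%:A.

Lemma unitary_scalar (z : R[i]) : `|z| = 1 -> unitary_elt (z%:A : A).
Proof.
move=> z1; have zz := conj_unit z1.
split; rewrite adjZ adj1 -scalerAl -scalerAr scalerA mulr1 ?zz ?scale1r //.
by rewrite mulrC zz scale1r.
Qed.

Lemma gauge_hom z : `|z| = 1 -> star_hom (gauge z).
Proof. by move=> z1; case: (cuntz_endoP SC (unitary_scalar z1)). Qed.

Lemma gauge_gen z i : `|z| = 1 -> gauge z (S i) = z *: S i.
Proof.
move=> z1; rewrite /gauge; case: (cuntz_endoP SC (unitary_scalar z1)) => _ ->.
by rewrite -scalerAl mul1r.
Qed.

Lemma gauge_word z mu : `|z| = 1 -> gauge z (W mu) = z ^+ size mu *: W mu.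
Proof.
move=> z1; have gP := gauge_hom z1; elim: mu => [|i mu IH].
  by rewrite word_nil (shom1 gP) scale1r.
by rewrite word_cons (shomM gP) IH gauge_gen // -scalerAl -scalerAr scalerA -exprS.
Qed.

(** Homogeneity of degree a - b.  Two naturals keep exponents nonnegative; only their
    difference matters, by [homog_eq]. *)
Definition homog (a b : nat) (x : A) := forall z : R[i], `|z| = 1 ->
  gauge z x = (z ^+ a * Num.conj z ^+ b) *: x.

Lemma homog_word mu nu : homog (size mu) (size nu) (W mu * adj (W nu)).
Proof.
move=> z z1; have gP := gauge_hom z1.
rewrite (shomM gP) (shom_adj gP) !gauge_word // adjZ -scalerAl -scalerAr scalerA.
by rewrite rmorphXn.
Qed.

Lemma homogM a b c d x y : homog a b x -> homog c d y -> homog (a + c) (b + d) (x * y).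
Proof.
move=> hx hy z z1; rewrite (shomM (gauge_hom z1)) hx // hy //.
by rewrite -scalerAl -scalerAr scalerA mulrACA !exprD.
Qed.

Lemma homog_adj a b x : homog a b x -> homog b a (adj x).
Proof.
move=> hx z z1; rewrite (shom_adj (gauge_hom z1)) hx // adjZ.
by rewrite rmorphM !rmorphXn /= conjCK mulrC.
Qed.

Lemma homogZ a b (c : R[i]) x : homog a b x -> homog a b (c *: x).
Proof. by move=> hx z z1; rewrite (shomZ (gauge_hom z1)) hx // !scalerA mulrC. Qed.

Lemma homogD a b x y : homog a b x -> homog a b y -> homog a b (x + y).
Proof. by move=> hx hy z z1; rewrite (shomD (gauge_hom z1)) hx // hy // scalerDr. Qed.

Lemma homog0 a b : homog a b 0.
Proof. by move=> z z1; rewrite (shom0 (gauge_hom z1)) scaler0. Qed.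

Lemma homog_eq a b c d x : (a + d = c + b)%N -> homog a b x -> homog c d x.
Proof.
move=> E hx z z1; rewrite hx //; congr (_ *: _); have zz := conj_unit z1.
rewrite -[LHS]mulr1 -(expr1n _ d) -zz exprMn mulrACA -!exprD E exprD.
rewrite -mulrA exprD [_ ^+ b * (_ ^+ b * _)]mulrA -exprMn zz expr1n mul1r //.
Qed.

(** The mean over the powers of z, to be used when z is a primitive N-th root of
    unity: on elements of degree less than N in absolute value it is the projection
    onto degree 0, like the conditional expectation onto the core. *)
Definition gauge_avg N (z : R[i]) (x : A) : A :=
  (N%:R)^-1 *: \sum_(j < N) gauge (z ^+ j) x.

Section Average.
Variables (N : nat) (z : R[i]) (zN : N.-primitive_root z).

Let zj (j : nat) : `|z ^+ j| = 1.
Proof. by rewrite normrX (prim_root_norm zN) expr1n. Qed.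

Let N0 : N%:R != 0 :> R[i].
Proof. by rewrite pnatr_eq0 -lt0n (prim_order_gt0 zN). Qed.

Lemma gauge_avg_homog a b x : (a < N)%N -> (b < N)%N -> homog a b x ->
  gauge_avg N z x = if a == b then x else 0.
Proof.
move=> aN bN hx; rewrite /gauge_avg (eq_bigr _ (fun j _ => hx _ (zj (nat_of_ord j)))).
rewrite -scaler_suml (prim_root_orth zN aN bN) scalerA.
by case: eqP => _; rewrite ?mul1r ?mulVf // ?scale1r // mul0r mulr0 scale0r.
Qed.

Lemma gauge_avg_sum (I : Type) (r : seq I) (P : pred I) (f : I -> A) :
  gauge_avg N z (\sum_(i <- r | P i) f i) = \sum_(i <- r | P i) gauge_avg N z (f i).
Proof.
rewrite /gauge_avg -scaler_sumr; congr (_ *: _); rewrite exchange_big /=.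
by apply: eq_bigr => j _; rewrite (shom_sum (gauge_hom (zj j))).
Qed.

Lemma gauge_avgB x y : gauge_avg N z (x - y) = gauge_avg N z x - gauge_avg N z y.
Proof.
rewrite /gauge_avg -scalerBr -sumrB; congr (_ *: _).
by apply: eq_bigr => j _; rewrite (shomB (gauge_hom (zj j))).
Qed.

Lemma gauge_avg_rnorm x : rnorm (gauge_avg N z x) <= 2 * rnorm x.
Proof.
have NR : (N%:R : R[i]) = (N%:R)%:C by rewrite rmorph_nat.
have N_gt0 : 0 < N%:R :> R by rewrite ltr0n (prim_order_gt0 zN).
rewrite /gauge_avg NR -fmorphV rnormZ_real ?invr_ge0 // ler_pdivrMl //.
apply: (le_trans (rnorm_sum _ _ _)).
have -> : N%:R * (2 * rnorm x) = \sum_(j < N) 2 * rnorm x.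
  by rewrite sumr_const card_ord -[RHS]mulr_natl.
apply: ler_sum => j _; exact: (shom_rnorm (gauge_hom (zj j))).
Qed.

End Average.

Definition core_gen : set A :=
  [set x | exists mu nu : word, size mu = size nu /\ x = W mu * adj (W nu)].

(** Polynomials in the S_i and their adjoints are dense, and are sums of homogeneous
    parts of degrees between - K and K.  The part of degree d - K is y d. *)
Lemma alg_decomp x (e : R) : 0 < e -> exists (K : nat) (y : nat -> A),
  [/\ forall d, homog d K (y d), lin_span core_gen (y K) &
      rnorm (x - \sum_(d < K.*2.+1) y d) < e].
Proof.
move=> e0; have [x' Wx' xx] := cuntz_dense x e0.
suff [K0 /(_ K0 (leqnn _)) [y [yh yc yE]]] : exists K0 : nat, forall K : nat, (K0 <= K)%N ->
    exists y : nat -> A, [/\ forall d, homog d K (y d), lin_span core_gen (y K) &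
       x' = \sum_(d < K.*2.+1) y d].
  by exists K0, y; rewrite -yE.
move: x' Wx' {xx}; apply: lin_span_ind => [|a _ y' [mu [nu ->]] [K0 IH]].
  exists 0%N => K _; exists (fun _ => 0); split.
  - by move=> d; exact: homog0.
  - exact: lin_span0.
  - by rewrite big1.
exists (maxn K0 (maxn (size mu) (size nu))) => K.
rewrite !geq_max => /and3P[/IH [y [yh yc yE]] muK nuK].
pose d0 := (size mu + K - size nu)%N.
pose w := a *: (W mu * adj (W nu)).
exists (fun d => (if d == d0 then w else 0) + y d); split.
- move=> d; apply: homogD => //; case: eqP => [->|_]; last exact: homog0.
  by apply: homogZ; apply: homog_eq (homog_word mu nu); rewrite /d0; lia.
- apply: lin_spanD => //; case: eqP => [E|_]; last exact: lin_span0.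
  apply: lin_spanZ; apply: lin_span_gen; exists mu, nu; split => //.
  by rewrite /d0 in E; lia.
- rewrite big_split /= -yE; congr (_ + _).
  have d0K : (d0 < K.*2.+1)%N by rewrite /d0 -addnn; lia.
  rewrite (bigD1 (Ordinal d0K)) //= eqxx big1 ?addr0 // => i i0.
  by rewrite (_ : (i == d0 :> nat) = false) //; apply/negbTE.
Qed.

Lemma homog00 x : homog 0 0 x <-> forall z : R[i], `|z| = 1 -> gauge z x = x.
Proof. by split => H z /H ->; rewrite !expr0 mulr1 scale1r. Qed.

(** A gauge invariant x within e of a polynomial is within 2 e of the polynomial's
    part of degree 0, by averaging; and that part lies in the core. *)
Lemma core_homog x : cuntz_core S x <-> homog 0 0 x.
Proof.
split.
  rewrite homog00; have gP := csub_forall (fun z z1 => fixed_csub (@gauge_hom z z1)).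
  apply: (closed_lin_span_sub gP) => _ [mu [nu [s ->]]] z z1 /=.
  have h00 : homog 0 0 (W mu * adj (W nu)).
    by apply: homog_eq (homog_word mu nu); rewrite s addn0.
  by move/homog00: h00; apply.
move=> hx; apply/closure_rnormP => e e0.
have [|K [y [yh yc yx]]] := @alg_decomp x (e / 2); first by rewrite divr_gt0.
exists (y K) => //.
have [z zN] := @prim_root_ex R K.*2.+1 isT.
have KN : (K < K.*2.+1)%N by rewrite -addnn; lia.
have <- : gauge_avg K.*2.+1 z (x - \sum_(d < K.*2.+1) y d) = x - y K.
  rewrite (gauge_avgB zN) (gauge_avg_homog zN _ _ hx) // eqxx; congr (_ - _).
  rewrite (gauge_avg_sum zN).
  under eq_bigr => d _ do rewrite (gauge_avg_homog zN (ltn_ord d) KN (yh _)).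
  rewrite (bigD1 (Ordinal KN)) //= eqxx big1 ?addr0 // => i i0.
  by rewrite (_ : (i == K :> nat) = false) //; apply/negbTE.
by apply: (le_lt_trans (gauge_avg_rnorm zN _)); lra.
Qed.

Lemma core_csub : closed_star_subalgebra (cuntz_core S).
Proof.
rewrite (_ : cuntz_core S = [set x | forall z : R[i], `|z| = 1 -> gauge z x = x]).
  exact: (csub_forall (fun z z1 => fixed_csub (@gauge_hom z z1))).
by apply/seteqP; split => x; rewrite /= -homog00 => /core_homog.
Qed.

End Gauge.

(** * The trace of the core *)

Section CoreTrace.
Context {R : realType} {A : cstarAlgType R} {n : nat} (S : 'I_n -> A).
Hypothesis SC : is_cuntz_algebra S.
Local Notation W := (S_word S).
Local Notation F := (cuntz_core S).
Let Sf : cuntz_family S. Proof. by case: SC. Qed.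
Let FP : closed_star_subalgebra F. Proof. exact: core_csub. Qed.

Lemma homog_core a x : homog S a a x -> F x.
Proof. by move=> hx; apply/(core_homog SC); apply: homog_eq hx; rewrite ?addn0 ?add0n. Qed.

Lemma core_word mu nu : size mu = size nu -> F (W mu * adj (W nu)).
Proof. by move=> s; apply: (@homog_core (size mu)); rewrite {2}s; exact: homog_word. Qed.

Lemma homog_Sword mu : homog S (size mu) 0 (W mu).
Proof.
have := homog_word SC mu [::]; rewrite word_nil adj1 mulr1; exact.
Qed.

Lemma homog_gen i : homog S 1 0 (S i).
Proof. by have := homog_Sword [:: i]; rewrite word_cons word_nil mulr1. Qed.

Lemma core_conj i x : F x -> F (S i * x * adj (S i)).
Proof.
move=> /(core_homog SC) hx; apply: (@homog_core 1).
exact: (homogM SC (homogM SC (homog_gen i) hx) (homog_adj SC (homog_gen i))).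
Qed.

Section OneTrace.
Variables (tau : A -> R[i]) (tauP : normalized_trace F tau).

Lemma tr_word_offdiag mu nu : size mu = size nu -> mu != nu ->
  tau (W mu * adj (W nu)) = 0.
Proof.
move=> s mn.
have -> : W mu * adj (W nu) = (W mu * adj (W mu)) * (W mu * adj (W nu)).
  by rewrite mulrA -(mulrA (W mu)) (word_iso Sf) mulr1.
rewrite (trC tauP); [|exact: core_word|exact: core_word].
rewrite mulrA -(mulrA (W mu)) (word_orth Sf (esym s)) eq_sym (negbTE mn).
by rewrite mulr0 mul0r (tr0 FP tauP).
Qed.

Lemma tr_word_eq mu nu : size mu = size nu ->
  tau (W mu * adj (W mu)) = tau (W nu * adj (W nu)).
Proof.
move=> s.
have -> : W mu * adj (W mu) = (W mu * adj (W nu)) * (W nu * adj (W mu)).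
  by rewrite mulrA -(mulrA (W mu)) (word_iso Sf) mulr1.
rewrite (trC tauP); [|exact: core_word|exact: core_word].
by rewrite mulrA -(mulrA (W nu)) (word_iso Sf) mulr1.
Qed.

Lemma word_split mu : W mu * adj (W mu) = \sum_i W (rcons mu i) * adj (W (rcons mu i)).
Proof.
under eq_bigr => i _ do rewrite word_rcons adjM mulrA -(mulrA (W mu)).
by rewrite -mulr_suml -mulr_sumr (cuntz_sum Sf) mulr1.
Qed.

(** The n ^ k projections S_mu S_mu^*, for words mu of length k, have equal traces
    and add up to 1.  Stated without division. *)
Lemma tr_word mu : n%:R ^+ size mu * tau (W mu * adj (W mu)) = 1.
Proof.
elim/last_ind: mu => [|mu i IH].
  by rewrite word_nil adj1 mulr1 mul1r (tr1 tauP).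
rewrite size_rcons -[RHS]IH (word_split mu) (tr_sum FP tauP); last first.
  by move=> j _; exact: core_word.
have Ei (j : 'I_n) : true -> tau (W (rcons mu j) * adj (W (rcons mu j)))
    = tau (W (rcons mu i) * adj (W (rcons mu i))).
  by move=> _; apply: tr_word_eq; rewrite !size_rcons.
by rewrite (eq_bigr _ Ei) sumr_const card_ord -(mulr_natl (tau _)) mulrA exprSr.
Qed.

End OneTrace.

Lemma cuntz_natr_neq0 : n%:R != 0 :> R[i].
Proof.
rewrite pnatr_eq0; case: n S Sf => [S' [_]|//].
by rewrite big_ord0 => /esym/eqP; rewrite oner_eq0.
Qed.

(** Traces are bounded, and [tr_word] and [tr_word_offdiag] determine them on
    generators. *)
Lemma tr_unique tau tau' : normalized_trace F tau -> normalized_trace F tau' ->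
  forall x, F x -> tau x = tau' x.
Proof.
move=> tP tP'.
have agree mu nu : size mu = size nu -> tau (W mu * adj (W nu)) = tau' (W mu * adj (W nu)).
  move=> s; have [<-|mn] := eqVneq mu nu; last by rewrite !tr_word_offdiag.
  apply: (mulfI (expf_neq0 (size mu) cuntz_natr_neq0)); by rewrite !tr_word.
have span y : lin_span (core_gen S) y -> F y /\ tau y = tau' y.
  move: y; apply: lin_span_ind.
    by split; [exact: (csub0 FP) | rewrite !(tr0 FP)].
  move=> a _ y [mu [nu [s ->]]] [Fy yy].
  have Fw := core_word s; split; first exact: (csub_lin FP).
  by rewrite !(tr_lin tP) // !(tr_lin tP') // agree // yy.
move=> x Fx; apply/eqP; rewrite -subr_eq0 -normr_eq0 eq_le normr_ge0 andbT.
have le_e (e : R) : 0 < e -> `|tau x - tau' x| <= e%:C.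
  move=> e0; have e8 : 0 < e / 8 by rewrite divr_gt0.
  have /closure_rnormP/(_ _ e8) [y /span [Fy yy] xy] := Fx.
  have -> : tau x - tau' x = tau (x - y) - tau' (x - y).
    by rewrite (trB FP tP) // (trB FP tP') // yy opprB addrA subrK.
  apply: (le_trans (ler_normB _ _)).
  have -> : e%:C = (4 * (e / 8))%:C + (4 * (e / 8))%:C :> R[i].
    by rewrite -rmorphD /=; congr (_ +i* _); lra.
  by apply: lerD; [apply: (tr_bound FP tP) | apply: (tr_bound FP tP')];
    rewrite ?(ltW xy) //; exact: (csubB FP).
have [r rE] : exists r : R, `|tau x - tau' x| = r%:C.
  by exists (complex.Re `|tau x - tau' x|); rewrite RRe_real ?ger0_real.
rewrite rE in le_e *; rewrite lecR leNgt; apply/negP => r0.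
have r2 : 0 < r / 2 by rewrite divr_gt0.
have := le_e _ r2; rewrite lecR; lra.
Qed.

Lemma tr_comp tau (f : A -> A) : normalized_trace F tau -> star_hom f ->
  (forall x, F x -> F (f x)) -> normalized_trace F (tau \o f).
Proof.
move=> tP fP fF; split=> /=.
- by move=> a x y Fx Fy; rewrite (shom_lin fP) (tr_lin tP) //; exact: fF.
- by move=> x Fx; rewrite (shomM fP) (shom_adj fP); apply: (tr_ge0 tP); exact: fF.
- by rewrite (shom1 fP) (tr1 tP).
- by move=> x y Fx Fy; rewrite !(shomM fP) (trC tP) //; exact: fF.
Qed.

Lemma tr_invariant tau f : normalized_trace F tau -> star_hom f ->
  (forall x, F x -> F (f x)) -> forall x, F x -> tau (f x) = tau x.
Proof. by move=> tP fP fF; apply: (tr_unique (tr_comp tP fP fF) tP). Qed.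

Section Scaling.
Variables (tau : A -> R[i]) (tauP : normalized_trace F tau).

(** The right-hand side is a normalized trace of the core, and there is only one. *)
Lemma tr_shift i x : F x -> tau x = n%:R * tau (S i * x * adj (S i)).
Proof.
move: x; apply: (tr_unique tauP); split.
- move=> a x y Fx Fy; rewrite mulrDr mulrDl -scalerAr -scalerAl (tr_lin tauP).
  + by rewrite mulrDr mulrCA.
  + exact: core_conj.
  + exact: core_conj.
- move=> x Fx; apply: mulr_ge0 => //.
  have -> : S i * (adj x * x) * adj (S i) =
      adj (S i * x * adj (S i)) * (S i * x * adj (S i)).
    rewrite !adjM adjK !mulrA -(mulrA _ (adj (S i)) (S i)) (cuntz_iso Sf).
    by rewrite mulr1.
  by apply: (tr_ge0 tauP); exact: core_conj.
- have := tr_word tauP [:: i].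
  by rewrite word_cons word_nil !mulr1 expr1.
- move=> x y Fx Fy; congr (_ * _).
  have E s t : S i * (s * t) * adj (S i) = (S i * s * adj (S i)) * (S i * t * adj (S i)).
    by rewrite !mulrA -(mulrA _ (adj (S i)) (S i)) (cuntz_iso Sf) mulr1.
  by rewrite !E (trC tauP) //; exact: core_conj.
Qed.

Lemma tr_shift_word mu x : F x -> tau x = n%:R ^+ size mu * tau (W mu * x * adj (W mu)).
Proof.
elim: mu => [|i mu IH] Fx; first by rewrite word_nil adj1 mulr1 !mul1r.
rewrite IH // word_cons adjM /= (@tr_shift i) ?mulrA ?exprSr //.
apply: (@homog_core (size mu)); have := homog_Sword mu => h.
have := homogM SC (homogM SC h ((core_homog SC _).1 Fx)) (homog_adj SC h).
by rewrite !addn0.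
Qed.

Variable i0 : 'I_n.

(** Let V be a word of length k.  Then y adj V and V adj y lie in the core and
    may be exchanged under the trace, and passing from adj y * y to
    V (adj y * y) adj V costs n ^ k by [tr_shift_word]. *)
Lemma tr_homog k b y : homog S (b + k) b y ->
  tau (adj y * y) = n%:R ^+ k * tau (y * adj y) /\ 0 <= tau (y * adj y).
Proof.
move=> hy; pose V := W (nseq k i0).
have hV : homog S k 0 V by have := homog_Sword (nseq k i0); rewrite size_nseq.
have FyV : F (y * adj V).
  apply: (@homog_core (b + k)).
  by have := homogM SC hy (homog_adj SC hV); rewrite addn0.
have FVy : F (V * adj y) by have := csub_adj FP FyV; rewrite adjM adjK.
have Fyy : F (adj y * y).
  by apply: (@homog_core (b + (b + k))); have := homogM SC (homog_adj SC hy) hy; rewrite [(b + k + b)%N]addnC.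
have VV : adj V * V = 1 by exact: word_iso.
have yy : y * adj V * (V * adj y) = y * adj y.
  by rewrite mulrA -(mulrA y) VV mulr1.
split.
  rewrite (tr_shift_word (nseq k i0) Fyy) size_nseq -/V; congr (_ * _).
  by rewrite -yy [RHS](trC tauP) // !mulrA.
have := tr_ge0 tauP FVy; rewrite adjM adjK yy; exact.
Qed.

(** For degree a - b >= 0 the trace decreases; for degree a - b < 0 it grows by
    n ^ (b - a), which is at most n ^ b. *)
Lemma tr_homog_le a b y : homog S a b y -> tau (y * adj y) <= n%:R ^+ b * tau (adj y * y).
Proof.
move=> hy; have n1 : 1 <= n%:R :> R[i] by rewrite ler1n; case: (n) i0 => [[]|].
have [ba|ab] := leqP b a.
  have [|-> y0] := @tr_homog (a - b) b y; first by rewrite subnKC.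
  by rewrite mulrA -exprD ler_peMl // exprn_ege1.
have [|+ y0] := @tr_homog (b - a) a (adj y).
  by rewrite subnKC ?(ltnW ab) //; exact: homog_adj.
rewrite adjK in y0 *; move=> ->; apply: ler_wpM2r => //.
by apply: ler_weXn2l => //; exact: leq_subr.
Qed.

(** Since w is only approximated by polynomials, C comes from one fixed approximation,
    close enough to serve for all p and q at once. *)
Lemma tr_conj_le w : unitary_elt w -> exists2 C : R, 0 < C &
  forall p q, F p -> F q -> is_projection p -> is_projection q ->
    p = w * q * adj w -> tau p <= C%:C * tau q.
Proof.
move=> wU.
have [|K [y [yh _ yw]]] := alg_decomp SC w (_ : 0 < (24%:R)^-1); first by rewrite invr_gt0.
set w' := \sum_(d < _) y d in yw.
pose M d := rnorm (y d) ^+ 2 + 1.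
have M0 d : 0 < M d by rewrite ltr_wpDl // exprn_ge0 // rnorm_ge0.
pose C : R := 2 * (\sum_(d < K.*2.+1) n%:R ^+ K * (2 * M d)) + 1.
have C0 : 0 < C.
  rewrite ltr_wpDl // mulr_ge0 // sumr_ge0 // => d _.
  by rewrite !mulr_ge0 ?exprn_ge0 // ltW.
exists C => // p q Fp Fq pP qP pE.
have [pp ps] := pP; have [qq qs] := qP.
have hp := (core_homog SC p).1 Fp; have hq := (core_homog SC q).1 Fq.
pose x d := p * y d * q.
have hx d : homog S d K (x d).
  by have := homogM SC (homogM SC hp (yh d)) hq; rewrite !addn0 !add0n.
pose a := \sum_(d < K.*2.+1) x d * adj (x d).
have Fxx d : F (x d * adj (x d)).
  apply: (@homog_core (d + K)); have := homogM SC (hx d) (homog_adj SC (hx d)).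
  by rewrite [(K + d)%N]addnC.
have Fa : F a by apply: (csub_sum FP).
have asa : adj a = a.
  by rewrite /a adj_sum; apply: eq_bigr => d _; rewrite adjM adjK.
have pap : p * a * p = a.
  rewrite /a mulr_sumr mulr_suml; apply: eq_bigr => d _.
  rewrite /x !adjM ps qs !mulrA pp -!mulrA; do 5 congr (_ * _).
  by rewrite pp.
(* p - a is the gauge average of p - u' adj u' with u' = p w' q, and p = u adj u
   for u = p w q; as norm (u - u') <= 1/24, the averaged element has norm at most
   (2 + 1/24) / 24, which leaves room for the factor 2 of [gauge_avg_rnorm]. *)
have pa : rnorm (p - a) <= 4^-1.
  have [z zN] := @prim_root_ex R K.*2.+1 isT.
  have -> : p - a = gauge_avg S K.*2.+1 z (p - p * w' * q * adj (p * w' * q)).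
    rewrite (gauge_avgB SC zN) (gauge_avg_homog zN _ _ hp) // eqxx; congr (_ - _).
    have -> : p * w' * q * adj (p * w' * q) = \sum_(d < K.*2.+1) \sum_(e < K.*2.+1) x d * adj (x e).
      rewrite /w' mulr_sumr mulr_suml adj_sum mulr_suml; apply: eq_bigr => d _.
      by rewrite mulr_sumr.
    rewrite (gauge_avg_sum SC zN) /a; apply: eq_bigr => d _.
    rewrite (gauge_avg_sum SC zN) (bigD1 d) //= big1 ?addr0 => [|e ed].
      rewrite (gauge_avg_homog zN (ltn_ord d) (ltn_ord d)) ?eqxx //.
      apply: homog_eq (homogM SC (hx d) (homog_adj SC (hx d))); lia.
    rewrite (gauge_avg_homog zN (ltn_ord d) (ltn_ord e)).
      by rewrite (_ : (d == e :> nat) = false) //; apply/negbTE; rewrite eq_sym.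
    apply: homog_eq (homogM SC (hx d) (homog_adj SC (hx e))); lia.
  apply: (le_trans (gauge_avg_rnorm SC zN _)).
  have pw : p * w * q * adj (p * w * q) = p.
    rewrite !adjM ps qs !mulrA -(mulrA (p * w)) qq -!mulrA (mulrA q) (mulrA w).
    by rewrite (mulrA w) -pE pp pp.
  have u1 : rnorm (p * w * q) <= 1.
    apply: rnorm_prod_le1; last exact: rnorm_proj_le1.
    by apply: rnorm_prod_le1; [exact: rnorm_proj_le1 | rewrite rnorm_unitary].
  have du : rnorm (p * w * q - p * w' * q) <= 24%:R^-1.
    rewrite -mulrBl -mulrBr; apply: (le_trans (rnormM _ _)).
    have q1 := rnorm_proj_le1 qP; have p1 := rnorm_proj_le1 pP.
    have := rnormM p (w - w'); have := rnorm_ge0 p; have := rnorm_ge0 q.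
    by have := rnorm_ge0 (p * (w - w')); have := rnorm_ge0 (w - w'); nra.
  rewrite -[X in X - _]pw; move: u1 du; set u := p * w * q; set u' := p * w' * q => u1 du.
  have -> : u * adj u - u' * adj u' = u * adj (u - u') + (u - u') * adj u'.
    by rewrite adjB mulrBr mulrBl addrA subrK.
  have u'n : rnorm u' <= rnorm u + rnorm (u - u').
    by have := rnormB_tri u' u 0; rewrite !subr0 rnormBC; lra.
  have := rnormD (u * adj (u - u')) ((u - u') * adj u').
  have := rnormM u (adj (u - u')); have := rnormM (u - u') (adj u').
  rewrite !rnorm_adj; have := rnorm_ge0 u; have := rnorm_ge0 (u - u'); have := rnorm_ge0 u'.
  by nra.
have q0 : 0 <= tau q by exact: (tr_proj_ge0 tauP).
apply: (le_trans (tr_close_le FP tauP Fp Fa pP asa pap pa)).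
rewrite /a (tr_sum FP tauP) //.
(* The degree of x d is d - K, so exchanging its factors costs at most n ^ K. *)
have term (d : 'I_(K.*2.+1)) : true -> tau (x d * adj (x d)) <= (n%:R ^+ K * (2 * M d))%:C * tau q.
  move=> _; apply: (le_trans (tr_homog_le (hx d))).
  rewrite rmorphM /= -mulrA rmorphXn rmorph_nat; apply: ler_wpM2l; first by rewrite exprn_ge0.
  have -> : adj (x d) * x d = q * (adj (y d) * p * y d) * q.
    by rewrite /x !adjM ps qs !mulrA -(mulrA _ p p) pp.
  apply: (tr_compress FP tauP) => //.
  - apply: (@homog_core (K + d)).
    have := homogM SC (homogM SC (homog_adj SC (yh d)) hp) (yh d).
    by rewrite !addn0 [(d + K)%N]addnC.
  - by rewrite !adjM adjK ps mulrA.
  - apply: (le_trans (rnormM _ _)).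
    have := rnormM (adj (y d)) p; rewrite rnorm_adj; have := rnorm_proj_le1 pP.
    have := rnorm_ge0 (y d); have := rnorm_ge0 p; have := rnorm_ge0 (adj (y d) * p).
    by rewrite /M; nra.
apply: (le_trans (ler_wpM2l _ (ler_sum _ term))) => //.
rewrite -mulr_suml mulrA -rmorph_sum /=; apply: ler_wpM2r => //.
rewrite -[2](rmorph_nat (real_complex R)) -rmorphM lecR /C /=; lra.
Qed.

End Scaling.

End CoreTrace.

(** * The diagonal and permutation unitaries *)

Section Diagonal.
Context {R : realType} {A : cstarAlgType R} {n : nat} (S : 'I_n -> A).
Hypothesis SC : is_cuntz_algebra S.
Local Notation W := (S_word S).
Local Notation F := (cuntz_core S).
Local Notation D := (cuntz_diag S).
Let Sf : cuntz_family S. Proof. by case: SC. Qed.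
Let FP : closed_star_subalgebra F. Proof. exact: core_csub. Qed.

Definition word_proj (mu : word) : A := W mu * adj (W mu).
Local Notation E := word_proj.

Lemma word_proj_proj mu : is_projection (E mu).
Proof.
split; last by rewrite /E adjM adjK.
by rewrite /E mulrA -(mulrA (W mu)) (word_iso Sf) mulr1.
Qed.

Lemma word_proj_core mu : F (E mu).
Proof. by apply: core_word. Qed.

Lemma word_proj_comm mu nu : E nu * E mu = E mu * E nu.
Proof.
have [_ es] := word_proj_proj mu; have [_ ens] := word_proj_proj nu.
suff s : adj (E nu * E mu) = E nu * E mu by rewrite -s adjM es ens.
have EE : E nu * E mu = W nu * (adj (W nu) * W mu) * adj (W mu) by rewrite /E !mulrA.
rewrite EE; case: (word_mul Sf nu mu) => [->|[g mE ->]|[g nE ->]].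
- by rewrite mulr0 mul0r adj0.
- by rewrite -word_cat -mE -/(E mu) es.
- by rewrite -mulrA -adjM -word_cat -nE -/(E nu) ens.
Qed.

Lemma diag_comm x mu : D x -> x * E mu = E mu * x.
Proof.
have [_ es] := word_proj_proj mu.
apply: (closed_lin_span_sub (commutant_csub es)) => _ [nu ->] /=.
exact: word_proj_comm.
Qed.

Lemma diag_core : D `<=` F.
Proof. by apply: closed_lin_span_sub => // _ [mu ->]; exact: word_proj_core. Qed.

(** Compressing S_nu S_nu^* by a word at least as long as nu gives 1 or 0. *)
Lemma diag_compress_scalar y :
  lin_span [set x | exists mu : word, x = W mu * adj (W mu)] y ->
  exists K : nat, forall mu : word, (K <= size mu)%N ->
    exists c : R[i], adj (W mu) * y * W mu = c%:A.
Proof.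
move: y; apply: lin_span_ind.
  by exists 0%N => mu _; exists 0; rewrite mulr0 mul0r scale0r.
move=> a _ y [nu ->] [K IH]; exists (maxn K (size nu)) => mu.
rewrite geq_max => /andP[/IH [c cE] numu].
have [d dE] : exists d : R[i], adj (W mu) * (W nu * adj (W nu)) * W mu = d%:A.
  have -> : adj (W mu) * (W nu * adj (W nu)) * W mu
      = adj (adj (W nu) * W mu) * (adj (W nu) * W mu) by rewrite adjM adjK !mulrA.
  case: (word_mul Sf nu mu) => [->|[g _ ->]|[g nE ->]].
  - by exists 0; rewrite mulr0 scale0r.
  - by exists 1; rewrite (word_iso Sf) scale1r.
  - have /size0nil -> : size g = 0%N by move: numu; rewrite nE size_cat; lia.
    by exists 1; rewrite word_nil !adj1 mulr1 scale1r.
exists (a * d + c).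
by rewrite mulrDr mulrDl -scalerAr -scalerAl dE cE scalerA scalerDl.
Qed.

Lemma word_right_neq0 (P : A) k : P != 0 -> exists2 mu : word, size mu = k & P * W mu != 0.
Proof.
move=> P0; elim: k => [|k [mu sk Pmu]]; first by exists [::]; rewrite ?word_nil ?mulr1.
have [/forallP H|] := boolP [forall i, P * W (rcons mu i) == 0].
  move: Pmu; rewrite -[W mu]mulr1 -(cuntz_sum Sf) !mulr_sumr big1 ?eqxx // => i _.
  by rewrite !mulrA -(mulrA P) -word_rcons (eqP (H i)) mul0r.
by rewrite negb_forall => /existsP [i Pi]; exists (rcons mu i); rewrite ?size_rcons ?sk.
Qed.

(** Compressing P by a long word mu gives a projection close to a scalar, which is 1
    if it is not 0.  Some mu gives a nonzero one, since the S_mu S_mu^* of a given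
    length add up to 1. *)
Lemma diag_proj_ge_word (P : A) : is_projection P -> D P -> P != 0 ->
  exists mu, P * E mu = E mu.
Proof.
move=> [pp ps] DP P0.
have /closure_rnormP/(_ 4^-1) [|y Dy Py] := DP; first by rewrite invr_gt0.
have [K HK] := diag_compress_scalar Dy.
have [mu sK Pmu] := word_right_neq0 K P0.
have [|c cE] := HK mu; first by rewrite sK.
exists mu.
pose q := adj (W mu) * P * W mu.
have PE := diag_comm mu DP.
have WE : E mu * W mu = W mu by rewrite /E -mulrA (word_iso Sf) mulr1.
have qP : is_projection q.
  split; last by rewrite /q !adjM adjK ps mulrA.
  have -> : q * q = adj (W mu) * (P * (E mu * P)) * W mu by rewrite /q /E !mulrA.
  by rewrite -PE (mulrA P P) pp -(mulrA (adj _)) -(mulrA P) WE /q mulrA.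
have q0 : q != 0.
  apply: contra Pmu => /eqP q0; apply/eqP; apply: rnorm_eq0; apply/eqP.
  rewrite -sqrf_eq0 -rnorm_cstar adjM ps mulrA -(mulrA _ P P) pp -/q q0.
  by rewrite rnorm0.
have q1 : q = 1.
  apply: (proj_near_scalar (c := c) qP q0); rewrite -cE /q -mulrBl -mulrBr.
  apply: (le_trans (rnormM _ _)); have := rnormM (adj (W mu)) (P - y).
  rewrite rnorm_adj; have := word_rnorm Sf mu; have := rnorm_ge0 (W mu).
  by have := rnorm_ge0 (P - y); have := rnorm_ge0 (adj (W mu) * (P - y)); nra.
have [EE _] := word_proj_proj mu.
have -> : P * E mu = W mu * q * adj (W mu).
  have -> : W mu * q * adj (W mu) = E mu * P * E mu by rewrite /q /E !mulrA.
  by rewrite -PE -mulrA EE.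
by rewrite q1 mulr1.
Qed.

(** P dominates some S_mu S_mu^*, of trace n ^- size mu. *)
Lemma tr_diag_gt0 (tau : A -> R[i]) (P : A) : normalized_trace F tau ->
  is_projection P -> D P -> P != 0 -> 0 < tau P.
Proof.
move=> tP PP DP P0; have [mu PE] := diag_proj_ge_word PP DP P0.
have FP' := diag_core DP; have FE : F (E mu) by exact: word_proj_core.
have [pp ps] := PP; have [ee es] := word_proj_proj mu.
have EP : E mu * P = E mu by rewrite -[in LHS]es -[in LHS]ps -adjM PE es.
have dP : is_projection (P - E mu).
  split; last by rewrite adjB ps es.
  by rewrite mulrBl !mulrBr pp PE EP ee subrr subr0.
have -> : tau P = tau (E mu) + tau (P - E mu) by rewrite (trB FP tP) // addrC subrK.
have d0 := tr_proj_ge0 tP (csubB FP FP' FE) dP.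
apply: (lt_le_trans _ (_ : tau (E mu) <= _)); last by rewrite lerDl.
rewrite lt_def (tr_proj_ge0 tP FE (word_proj_proj mu)) andbT.
apply/eqP => t0; have := tr_word SC tP mu; rewrite -/(E mu) t0 mulr0.
by move/esym/eqP; rewrite oner_eq0.
Qed.

Section PermutationUnitary.
Variables (u : A) (uS : cuntz_perm_unitary S u).

(** The part of degree 0 of adj x * x, for x the sum of the words in s, is the number
    of pairs (g, h) of positions of s that carry the same word.  Being 1, this
    number leaves room for one position only. *)
Lemma word_sum_isometry (s : seq (word (n := n))) :
  adj (\sum_(g <- s) W g) * (\sum_(g <- s) W g) = 1 -> exists g, s = [:: g].
Proof.
move=> H.
pose N := (\max_(g <- s) size g).+1.
have [z zN] := @prim_root_ex R N isT.
have sN g : g \in s -> (size g < N)%N by move=> gs; rewrite ltnS leq_bigmax_seq.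
have av g h : g \in s -> h \in s -> gauge_avg S N z (adj (W g) * W h) = (g == h)%:R.
  move=> /sN gN /sN hN; rewrite (gauge_avg_homog zN hN gN); last first.
    by have := homogM SC (homog_adj SC (homog_Sword SC g)) (homog_Sword SC h); rewrite addn0.
  case: eqP => [/esym e|e]; first exact: word_orth.
  by case: eqP => // gh; case: e; rewrite gh.
have : gauge_avg S N z 1 = (\sum_(g <- s) \sum_(h <- s) (g == h : nat))%N%:R.
  rewrite -[in LHS]H adj_sum mulr_suml (gauge_avg_sum SC zN) natr_sum.
  apply: eq_big_seq => g gs; rewrite mulr_sumr (gauge_avg_sum SC zN) natr_sum.
  by apply: eq_big_seq => h hs; exact: av.
have h1 : homog S 0 0 1 by apply/(core_homog SC); exact: (csub1 FP).
rewrite (gauge_avg_homog zN _ _ h1) // eqxx.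
case: s H {N z zN sN av} => [|g [|h s]] H.
- by rewrite big_nil => /eqP; rewrite oner_eq0.
- by move=> _; exists g.
rewrite !big_cons !eqxx /= => /eqP.
set m := (X in X%:R); have m2 : (2 <= m)%N by rewrite /m; lia.
rewrite eq_sym -subr_eq0 => /eqP m1.
have /eqP : (m%:R - 1 : R[i]) *: (1 : A) = 0 by rewrite scalerBl scaler_nat scale1r.
rewrite scaler_eq0 oner_eq0 orbF subr_eq0 pnatr_eq1 => /eqP m_eq1.
by rewrite m_eq1 in m2.
Qed.

(** If mu is longer than all the words beta of u, then u W_mu is a sum of words; it
    is an isometry, so there is just one. *)
Lemma perm_word : exists K : nat, forall mu : word, (K <= size mu)%N ->
  exists g, u * W mu = W g.
Proof.
have [[u1 _] [J [_ uE]]] := uS.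
suff [K HK] : exists K : nat, forall mu : word, (K <= size mu)%N ->
    exists s : seq (word (n := n)), u * W mu = \sum_(g <- s) W g.
  exists K => mu /HK [s sE].
  have [|g gE] := @word_sum_isometry s.
    by rewrite -sE adjM mulrA -(mulrA _ (adj u)) u1 mulr1 (word_iso Sf).
  by exists g; rewrite sE gE big_seq1.
rewrite uE; elim: J {uE} => [|[al be] J [K IH]].
  by exists 0%N => mu _; exists [::]; rewrite !big_nil mul0r.
exists (maxn K (size be)) => mu; rewrite geq_max => /andP[/IH [s sE] bemu].
rewrite big_cons /= mulrDl sE -mulrA.
case: (word_mul Sf be mu) => [->|[g _ ->]|[g bE ->]].
- by exists s; rewrite mulr0 add0r.
- by exists ((al ++ g) :: s); rewrite big_cons word_cat.
- have /size0nil -> : size g = 0%N by move: bemu; rewrite bE size_cat; lia.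
  by exists (al :: s); rewrite big_cons word_nil adj1 mulr1.
Qed.

Definition sum_word_proj (x : A) := exists s : seq (word (n := n)), x = \sum_(g <- s) E g.

Lemma sum_word_proj_sum (I : Type) (r : seq I) (f : I -> A) :
  (forall i, sum_word_proj (f i)) -> sum_word_proj (\sum_(i <- r) f i).
Proof.
move=> Hf; elim/big_ind: _ => //; first by exists [::]; rewrite big_nil.
by move=> _ _ [s ->] [t ->]; exists (s ++ t); rewrite big_cat.
Qed.

(** For long mu this is [perm_word]; a short mu is first replaced by the sum over its
    extensions by one letter, repeatedly. *)
Lemma perm_conj_word_proj mu : sum_word_proj (u * E mu * adj u).
Proof.
have [K HK] := perm_word.
suff H k : forall mu, (K <= size mu + k)%N -> sum_word_proj (u * E mu * adj u).
  by apply: (H K); exact: leq_addl.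
elim: k => [|k IH] {}mu Kmu.
  have [|g gE] := HK mu; first by rewrite addn0 in Kmu.
  by exists [:: g]; rewrite big_seq1 /E -gE adjM !mulrA.
rewrite /E (word_split SC) mulr_sumr mulr_suml; apply: sum_word_proj_sum => i.
by apply: IH; rewrite size_rcons addSnnS.
Qed.

Lemma endo_word_proj mu : sum_word_proj (cuntz_endo S u (E mu)).
Proof.
have [fP fS] := cuntz_endoP SC uS.1.
elim: mu => [|i mu [s sE]].
  by exists [:: [::]]; rewrite big_seq1 /E word_nil adj1 mulr1 (shom1 fP).
have -> : E (i :: mu) = S i * E mu * adj (S i) by rewrite /E word_cons adjM !mulrA.
rewrite 2!(shomM fP) (shom_adj fP) fS sE adjM.
have -> : u * S i * (\sum_(g <- s) E g) * (adj (S i) * adj u)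
    = \sum_(g <- s) u * E (i :: g) * adj u.
  rewrite mulr_sumr mulr_suml; apply: eq_bigr => g _.
  by rewrite /E word_cons adjM !mulrA.
by apply: sum_word_proj_sum => g; exact: perm_conj_word_proj.
Qed.

Lemma perm_endo_diag x : D x -> F (cuntz_endo S u x).
Proof.
have [fP _] := cuntz_endoP SC uS.1; move: x.
apply: (closed_lin_span_sub (preimage_csub fP FP)) => _ [mu ->] /=.
have [s ->] := endo_word_proj mu.
by apply: (csub_sum FP) => g _; exact: word_proj_core.
Qed.

End PermutationUnitary.

(** The gauge action commutes with L_v, because both composites are the endomorphism
    of the unitary z *: v; so L_v preserves gauge invariant elements. *)
Lemma endo_core (v : A) : unitary_elt v -> F v -> forall x, F x -> F (cuntz_endo S v x).
Proof.
move=> vU Fv x Fx; have [fP fS] := cuntz_endoP SC vU.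
apply/(core_homog SC)/(homog00 S) => z z1.
have gP := gauge_hom SC z1; have zz := conj_unit z1.
have zvU : unitary_elt (z *: v).
  have [v1 v2] := vU.
  split; rewrite adjZ -scalerAl -scalerAr scalerA ?v1 ?v2 ?zz ?scale1r //.
  by rewrite mulrC zz scale1r.
have gv : gauge S z v = v by move/(core_homog SC)/(homog00 S) : Fv; apply.
have gx : gauge S z x = x by move/(core_homog SC)/(homog00 S) : Fx; apply.
have e1 : gauge S z \o cuntz_endo S v = cuntz_endo S (z *: v).
  apply: (cuntz_endo_unique SC zvU (star_hom_comp gP fP)) => i /=.
  by rewrite fS (shomM gP) gv (gauge_gen SC) // -scalerAr -scalerAl.
have e2 : cuntz_endo S v \o gauge S z = cuntz_endo S (z *: v).
  apply: (cuntz_endo_unique SC zvU (star_hom_comp fP gP)) => i /=.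
  by rewrite (gauge_gen SC) // (shomZ fP) fS -scalerAl.
by have := congr1 (fun h => h x) (etrans e1 (esym e2)); rewrite /= gx.
Qed.

End Diagonal.

(** * The theorem *)

Section Main.
Context {R : realType} {A : cstarAlgType R} {n : nat} (S : 'I_n -> A).
Hypothesis SC : is_cuntz_algebra S.
Local Notation F := (cuntz_core S).

Lemma ratio_bounded (i0 : 'I_n) (tau : A -> R[i]) (f : A -> A) (w : A) :
  normalized_trace F tau -> star_hom f -> unitary_elt w ->
  (forall x, F x -> F (adj w * f x * w)) ->
  exists2 C : R, 0 < C & forall p, is_projection p -> F p -> F (f p) ->
    tau (f p) <= C%:C * tau p /\ tau p <= C%:C * tau (f p).
Proof.
move=> tP fP wU fF; have [w1 w2] := wU.
have awU := unitary_adj wU.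
have [C1 C10 H1] := tr_conj_le SC tP i0 wU.
have [C2 C20 H2] := tr_conj_le SC tP i0 awU.
have gP : star_hom (Ad (adj w) \o f) by apply: star_hom_comp => //; exact: Ad_hom.
have gF x : F x -> F ((Ad (adj w) \o f) x) by rewrite /Ad /= adjK; exact: fF.
exists (C1 + C2); first exact: addr_gt0.
move=> p pP Fp Ffp; have [pp ps] := pP.
have fpP : is_projection (f p) by split; rewrite -?(shomM fP) -?(shom_adj fP) ?pp ?ps.
set q := (Ad (adj w) \o f) p.
have qP : is_projection q by split; rewrite -?(shomM gP) -?(shom_adj gP) ?pp ?ps.
have Fq : F q by exact: gF.
have tq : tau q = tau p by exact: (tr_invariant SC tP gP gF).
have p0 : 0 <= tau p by exact: (tr_proj_ge0 tP).
have fp0 : 0 <= tau (f p) by exact: (tr_proj_ge0 tP).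
split.
  have := H1 _ _ Ffp Fq fpP qP; rewrite tq => H.
  apply: (le_trans (H _)).
    by rewrite /q /Ad /= adjK !mulrA w2 mul1r -mulrA w2 mulr1.
  by apply: ler_wpM2r => //; rewrite lecR lerDl ltW.
have := H2 _ _ Fq Ffp qP fpP; rewrite tq => H.
apply: (le_trans (H _)) => //.
by apply: ler_wpM2r => //; rewrite lecR lerDr ltW.
Qed.

End Main.

Theorem theorem4 (R : realType) (n : nat) (n_ge2 : (2 <= n)%N)
  (A : cstarAlgType R) (S : 'I_n -> A) (SC : is_cuntz_algebra S)
  (tau : A -> R[i]) (tauP : normalized_trace (cuntz_core S) tau)
  (u : A) (uS : cuntz_perm_unitary S u)
  (u_aut : star_automorphism (cuntz_endo S u))
  (P_ex : exists P : nat -> A,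
     (forall m : nat, (1 <= m)%N ->
        [/\ is_projection (P m), cuntz_diag S (P m) & P m <> 0]) /\
     let ratio := fun m : nat =>
       complex.Re (tau (cuntz_endo S u (P m))) / complex.Re (tau (P m)) in
     ((ratio m @[m --> \oo] --> +oo) \/ (ratio m @[m --> \oo] --> (0 : R)))) :
  (forall w v : A, unitary_elt w -> unitary_elt v -> cuntz_core S v ->
     cuntz_endo S u <> Ad w \o cuntz_endo S v) /\
  ~ (exists w : A, unitary_elt w /\
       Ad w @` cuntz_core S = cuntz_endo S u @` cuntz_core S).
Proof.
have [fP _] := cuntz_endoP SC uS.1.
have i0 : 'I_n by exact: (Ordinal (ltnW n_ge2)).
have key w : unitary_elt w ->
    (forall x, cuntz_core S x -> cuntz_core S (adj w * cuntz_endo S u x * w)) -> False.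
  move=> wU fF; have [C C0 HC] := ratio_bounded SC i0 tauP fP wU fF.
  have [P [PP]] := P_ex; set ratio := fun m : nat => _ => /= lim.
  have bounds m : (1 <= m)%N -> C^-1 <= ratio m <= C.
    move=> /PP [pP Dp /eqP p0].
    have [h1 h2] := HC _ pP (diag_core SC Dp) (perm_endo_diag SC uS Dp).
    have := tr_diag_gt0 SC tauP pP Dp p0; rewrite /ratio.
    move: h1 h2; case: (tau (P m)) => [a b]; case: (tau (cuntz_endo S u (P m))) => [c d].
    rewrite ltcE !lecE /= !mul0r !subr0 => /andP[_ h1] /andP[_ h2] /andP[_ a0].
    rewrite ler_pdivlMr // ler_pdivrMr // h1 andbT mulrC ler_pdivrMr //.
    by rewrite mulrC.
  case: lim => [/cvgryPgt /(_ C)|/cvgrPdist_lt /(_ C^-1)].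
    case=> N _ HN; have := HN (maxn N 1) (leq_maxl _ _).
    have := bounds (maxn N 1) (leq_maxr _ _) => /andP[_ +].
    by rewrite /= => /le_lt_trans h /h; rewrite ltxx.
  rewrite invr_gt0 => /(_ C0) [N _ HN]; have := HN (maxn N 1) (leq_maxl _ _).
  have := bounds (maxn N 1) (leq_maxr _ _) => /andP[lo _].
  rewrite /= sub0r normrN => /(le_lt_trans (ler_norm _)) /(le_lt_trans lo).
  by rewrite ltxx.
split=> [w v wU vU Fv uE|[w [wU FE]]]; have [w1 w2] := wU.
  apply: (key w wU) => x Fx; rewrite uE /Ad /= !mulrA w1 mul1r -mulrA w1 mulr1.
  exact: endo_core.
apply: (key w wU) => x Fx.
have : (cuntz_endo S u @` cuntz_core S) (cuntz_endo S u x) by exists x.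
rewrite -FE => -[y Fy <-].
by rewrite /Ad /= !mulrA w1 mul1r -mulrA w1 mulr1.
Qed.
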